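(* Let $(M,\omega)$ be a symplectic manifold, $V\to M$ a vector bundle with connection $\bar\Gamma$, and $\theta$ a section of $V^*$ defining a second-class constrained system with constraint surface $\Sigma=\{\theta=0\}$, as in the context. Let $\mathcal{D}^{ij}$ be the covariant Dirac bivector $$\mathcal{D}^{ij}=\omega^{ij}-\omega^{ik}\,\bar\nabla_k\theta_\alpha\,\Delta^{\alpha\beta}\,\bar\nabla_l\theta_\beta\,\omega^{lj},$$ and let $\{f,g\}_D=\partial_if\,\mathcal{D}^{ij}\,\partial_jg$ for $f,g\in C^\infty(M)$. Then $\mathcal{D}^{ij}$ is a well-defined bivector field on $M$, independent of the choice of the constraint basis (the local frame of $V$), which on $\Sigma$ coincides with the conventional Dirac bracket, and $\{\cdot,\cdot\}_D$ satisfies the Jacobi identity modulo terms vanishing on $\Sigma$: for all $f,g,h\in C^\infty(M)$, $$\Big(\{f,\{g,h\}_D\}_D+\{g,\{h,f\}_D\}_D+\{h,\{f,g\}_D\}_D\Big)\Big|_\Sigma=0.$$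
   Context: $x^i$ are local coordinates on $M$, $\omega=\omega_{ij}\,dx^i\wedge dx^j$, and $\omega^{ij}$ is the inverse matrix ($\omega^{ij}\omega_{jk}=\delta^i_k$). $e_\alpha$ is a local frame of $V$, and $\theta_\alpha$ are the components of the section $\theta$ of $V^*$ in the dual frame. The vanishing points of $\theta$ are regular and form a submanifold $\Sigma\subset M$ such that $\omega|_\Sigma$ is nondegenerate (second-class system). The connection is $\bar\nabla e_\alpha=dx^i\,\bar\Gamma^\beta_{i\alpha}e_\beta$, so $\bar\nabla_i\theta_\alpha=\partial_i\theta_\alpha-\bar\Gamma^\beta_{i\alpha}\theta_\beta$. Put $\Delta_{\alpha\beta}=\bar\nabla_i\theta_\alpha\,\omega^{ij}\,\bar\nabla_j\theta_\beta$; this matrix is assumed invertible on all of $M$ (it is automatically invertible near $\Sigma$), with inverse $\Delta^{\alpha\beta}$, $\Delta^{\alpha\gamma}\Delta_{\gamma\beta}=\delta^\alpha_\beta$. The conventional Dirac bracket, for local constraint functions $\theta_\alpha$, is $\{f,g\}-\{f,\theta_\alpha\}\,\Delta_0^{\alpha\beta}\,\{\theta_\beta,g\}$, where $\{f,g\}=\partial_if\,\omega^{ij}\,\partial_jg$ and $\Delta_0^{\alpha\beta}$ is the inverse of the matrix $\{\theta_\alpha,\theta_\beta\}$. *)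

(* Defs.v *)
From HB Require Import structures.
From mathcomp Require Import all_boot all_order all_algebra.
From mathcomp Require Import all_classical all_reals all_analysis.

Set Implicit Arguments.
Unset Strict Implicit.
Unset Printing Implicit Defensive.

Import Order.TTheory GRing.Theory Num.Theory.
Import numFieldNormedType.Exports.

Local Open Scope classical_set_scope.
Local Open Scope ring_scope.

(** * Smooth functions on open subsets of R^n *)

Definition iter_partial (R : realType) (n : nat) (s : seq 'I_n)
    (f : 'rV[R]_n -> R) : 'rV[R]_n -> R :=
  foldr (fun i g => 'D_(delta_mx 0 i) g) f s.

(* C^oo: all iterated partial derivatives exist and are (Frechet)
   differentiable, hence continuous. To be used with U open. *)
Definition smooth_on (R : realType) (n : nat) (U : set 'rV[R]_n)
    (f : 'rV[R]_n -> R) : Prop :=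
  forall (s : seq 'I_n) (p : 'rV[R]_n), U p ->
    differentiable (iter_partial s f) p.

(** * Smooth manifolds *)

(* The values of [chart_map] outside [chart_dom], and of [chart_inv] outside
   the image of [chart_dom], are irrelevant. *)
Record chart (R : realType) (n : nat) (M : topologicalType) := Chart {
  chart_dom : set M;
  chart_map :> M -> 'rV[R]_n;
  chart_inv : 'rV[R]_n -> M;
  chart_dom_open : open chart_dom;
  chart_img_open : open (chart_map @` chart_dom);
  chart_mapK : forall x, chart_dom x -> chart_inv (chart_map x) = x;
  chart_map_continuous : forall x, chart_dom x ->
    {for x, continuous chart_map};
  chart_inv_continuous : forall x, chart_dom x ->
    {for chart_map x, continuous chart_inv}
}.

Definition smooth_transition (R : realType) (n : nat) (M : topologicalType)
    (c c' : chart R n M) : Prop :=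
  forall i : 'I_n,
    smooth_on (c @` (chart_dom c `&` chart_dom c'))
      (fun p => c' (chart_inv c p) 0 i).

(* The atlas is maximal: [atlas c] says that [c] is a local coordinate system
   of the manifold. *)
Record manifold (R : realType) (n : nat) := Manifold {
  mfd_space :> topologicalType;
  mfd_hausdorff : hausdorff_space mfd_space;
  mfd_second_countable : @second_countable mfd_space;
  atlas : set (chart R n mfd_space);
  atlas_cover : forall x, exists c, atlas c /\ chart_dom c x;
  atlas_smooth : forall c c', atlas c -> atlas c' -> smooth_transition c c';
  atlas_maximal : forall c,
    (forall c', atlas c' -> smooth_transition c c' /\ smooth_transition c' c) ->
    atlas c
}.

Definition chart_at (R : realType) (n : nat) (M : manifold R n) (x : M) :
    chart R n M :=
  sval (cid (atlas_cover x)).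

(* To be used with U open. *)
Definition smooth_fun_on (R : realType) (n : nat) (M : manifold R n)
    (U : set M) (f : M -> R) : Prop :=
  forall c, atlas c ->
    smooth_on (c @` (U `&` chart_dom c)) (fun p => f (chart_inv c p)).

Definition smooth_fun (R : realType) (n : nat) (M : manifold R n)
    (f : M -> R) : Prop :=
  smooth_fun_on [set: M] f.

(* d f / d x^i at the point x, in the coordinates x^i given by the chart c *)
Definition partial (R : realType) (n : nat) (M : manifold R n)
    (c : chart R n M) (i : 'I_n) (f : M -> R) (x : M) : R :=
  'D_(delta_mx 0 i) (fun p => f (chart_inv c p)) (c x).

(* Jacobian of the coordinate change from x = c to x' = c'; differentials act
   on row vectors, so the entry (k, i) is d x'^i / d x^k. *)
Definition transition_jacobian (R : realType) (n : nat) (M : manifold R n)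
    (c c' : chart R n M) (x : M) : 'M[R]_n :=
  jacobian (fun p => c' (chart_inv c p)) (c x).

(** * Tensor fields, given by their components in every local chart *)

Record symplectic_form (R : realType) (n : nat) (M : manifold R n) :=
  SymplecticForm {
  omega_comp :> chart R n M -> M -> 'M[R]_n;
  omega_smooth : forall c i j, atlas c ->
    smooth_fun_on (chart_dom c) (fun x => omega_comp c x i j);
  omega_tensor : forall c c' x, atlas c -> atlas c' ->
    chart_dom c x -> chart_dom c' x ->
    omega_comp c x = transition_jacobian c c' x *m omega_comp c' x *m
                     (transition_jacobian c c' x)^T;
  omega_skew : forall c x, atlas c -> chart_dom c x ->
    (omega_comp c x)^T = - omega_comp c x;
  omega_closed : forall c x i j k, atlas c -> chart_dom c x ->
    partial c i (fun y => omega_comp c y j k) x +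
    partial c j (fun y => omega_comp c y k i) x +
    partial c k (fun y => omega_comp c y i j) x = 0;
  omega_nondegenerate : forall c x, atlas c -> chart_dom c x ->
    omega_comp c x \in unitmx
}.

Definition omega_inv (R : realType) (n : nat) (M : manifold R n)
    (omega : symplectic_form M) (c : chart R n M) (x : M) : 'M[R]_n :=
  invmx (omega c x).

Record bivector_field (R : realType) (n : nat) (M : manifold R n) :=
  BivectorField {
  bivector_comp :> chart R n M -> M -> 'M[R]_n;
  bivector_smooth : forall c i j, atlas c ->
    smooth_fun_on (chart_dom c) (fun x => bivector_comp c x i j);
  bivector_tensor : forall c c' x, atlas c -> atlas c' ->
    chart_dom c x -> chart_dom c' x ->
    bivector_comp c' x = (transition_jacobian c c' x)^T *m bivector_comp c x *m
                         transition_jacobian c c' x;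
  bivector_skew : forall c x, atlas c -> chart_dom c x ->
    (bivector_comp c x)^T = - bivector_comp c x
}.

(* d_i f B^{ij} d_j g in the chart c *)
Definition bracket_in (R : realType) (n : nat) (M : manifold R n)
    (c : chart R n M) (B : chart R n M -> M -> 'M[R]_n) (f g : M -> R)
    (x : M) : R :=
  \sum_(i < n) \sum_(j < n) partial c i f x * B c x i j * partial c j g x.

(* For tensorial B the choice of the chart around x does not matter. *)
Definition bracket (R : realType) (n : nat) (M : manifold R n)
    (B : chart R n M -> M -> 'M[R]_n) (f g : M -> R) (x : M) : R :=
  bracket_in (chart_at x) B f g x.

(** * Vector bundles and connections *)

Record local_frame (R : realType) (n m : nat) (M : manifold R n)
    (V : M -> vectType R) := LocalFrame {
  frame_dom : set M;
  frame_vec :> forall x, m.-tuple (V x);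
  frame_dom_open : open frame_dom;
  frame_basis : forall x, frame_dom x -> basis_of fullv (frame_vec x)
}.

Definition smooth_frame_change (R : realType) (n m : nat) (M : manifold R n)
    (V : M -> vectType R) (e e' : local_frame m V) : Prop :=
  forall a b : 'I_m, smooth_fun_on (frame_dom e `&` frame_dom e')
    (fun x => coord (e x) b (tnth (e' x) a)).

(* A vector bundle of rank m is a family of vector spaces together with the
   (maximal) set of its smooth local frames, i.e. its local trivializations. *)
Record vector_bundle (R : realType) (n : nat) (M : manifold R n) (m : nat) :=
  VectorBundle {
  fiber :> M -> vectType R;
  frames : set (local_frame m fiber);
  frames_cover : forall x, exists e, frames e /\ frame_dom e x;
  frames_smooth : forall e e', frames e -> frames e' ->
    smooth_frame_change e e';
  frames_maximal : forall e,
    (forall e', frames e' ->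
       smooth_frame_change e e' /\ smooth_frame_change e' e) ->
    frames e
}.

(* To be used with U open. *)
Definition smooth_section_on (R : realType) (n m : nat) (M : manifold R n)
    (V : vector_bundle M m) (U : set M) (s : forall x, V x) : Prop :=
  forall (e : local_frame m V) (a : 'I_m), frames e ->
    smooth_fun_on (U `&` frame_dom e) (fun x => coord (e x) a (s x)).

(* Components theta_a of theta in the frame dual to e *)
Definition theta_comp (R : realType) (n m : nat) (M : manifold R n)
    (V : vector_bundle M m) (theta : forall x, 'Hom(V x, R^o))
    (e : local_frame m V) (a : 'I_m) (x : M) : R :=
  theta x (tnth (e x) a).

Record dual_section (R : realType) (n m : nat) (M : manifold R n)
    (V : vector_bundle M m) := DualSection {
  dual_section_val :> forall x, 'Hom(V x, R^o);
  dual_section_smooth : forall (e : local_frame m V) (a : 'I_m), frames e ->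
    smooth_fun_on (frame_dom e) (theta_comp dual_section_val e a)
}.

(* [nabla c i s] is the covariant derivative of the local section s along
   d/dx^i in the chart c. Sections and functions are total, but only constrained
   to be smooth on U; locality follows from [nabla_leibniz] applied to the
   indicator function of a neighbourhood. *)
Record connection (R : realType) (n m : nat) (M : manifold R n)
    (V : vector_bundle M m) := Connection {
  nabla :> chart R n M -> 'I_n -> (forall x, V x) -> (forall x, V x);
  nabla_smooth : forall c i (U : set M) s, atlas c -> open U ->
    smooth_section_on U s -> smooth_section_on (U `&` chart_dom c) (nabla c i s);
  nabla_add : forall c i (U : set M) s t x, atlas c -> open U ->
    smooth_section_on U s -> smooth_section_on U t -> U x -> chart_dom c x ->
    nabla c i (fun y => s y + t y) x = nabla c i s x + nabla c i t x;
  nabla_leibniz : forall c i (U : set M) (f : M -> R) s x, atlas c -> open U ->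
    smooth_fun_on U f -> smooth_section_on U s -> U x -> chart_dom c x ->
    nabla c i (fun y => f y *: s y) x =
      partial c i f x *: s x + f x *: nabla c i s x;
  nabla_tensor : forall c c' k (U : set M) s x, atlas c -> atlas c' -> open U ->
    smooth_section_on U s -> U x -> chart_dom c x -> chart_dom c' x ->
    nabla c k s x =
      \sum_(i < n) transition_jacobian c c' x k i *: nabla c' i s x
}.

(* Gamma^b_{i a}, where nabla e_a = dx^i Gamma^b_{i a} e_b *)
Definition connection_coef (R : realType) (n m : nat) (M : manifold R n)
    (V : vector_bundle M m) (Gamma : connection V) (c : chart R n M)
    (e : local_frame m V) (i : 'I_n) (a b : 'I_m) (x : M) : R :=
  coord (e x) b (Gamma c i (fun y => tnth (e y) a) x).

(** * The constrained system *)

Definition constraint_surface (R : realType) (n m : nat) (M : manifold R n)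
    (V : vector_bundle M m) (theta : dual_section V) : set M :=
  [set x | theta x = 0].

Definition slice_chart (R : realType) (n : nat) (M : manifold R n)
    (S : set M) (k : nat) (c : chart R n M) : Prop :=
  atlas c /\ forall x, chart_dom c x ->
    (S x <-> forall i : 'I_n, (k <= i)%N -> c x 0 i = 0).

Definition submanifold (R : realType) (n : nat) (M : manifold R n)
    (S : set M) (k : nat) : Prop :=
  forall x, S x -> exists c, slice_chart S k c /\ chart_dom c x.

(* In a slice chart the vectors tangent to S are those whose components of
   index >= k vanish. *)
Definition nondegenerate_on (R : realType) (n : nat) (M : manifold R n)
    (omega : symplectic_form M) (S : set M) (k : nat) : Prop :=
  forall c x, slice_chart S k c -> chart_dom c x -> S x ->
  let tangent := [set v : 'rV[R]_n | forall i : 'I_n, (k <= i)%N -> v 0 i = 0] in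
  forall v, tangent v ->
    (forall w, tangent w -> v *m omega c x *m w^T = 0) -> v = 0.

Record second_class (R : realType) (n m : nat) (M : manifold R n)
    (V : vector_bundle M m) (omega : symplectic_form M)
    (theta : dual_section V) : Prop := SecondClass {
  constraint_regular : forall c (e : local_frame m V) x, atlas c -> frames e ->
    chart_dom c x -> frame_dom e x -> constraint_surface theta x ->
    row_free (\matrix_(a < m, i < n) partial c i (theta_comp theta e a) x);
  constraint_submanifold : submanifold (constraint_surface theta) (n - m);
  constraint_nondegenerate :
    nondegenerate_on omega (constraint_surface theta) (n - m)
}.

(* The matrix with entries nabla_i theta_a *)
Definition nabla_theta (R : realType) (n m : nat) (M : manifold R n)
    (V : vector_bundle M m) (Gamma : connection V) (theta : dual_section V)
    (c : chart R n M) (e : local_frame m V) (x : M) : 'M[R]_(n, m) :=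
  \matrix_(i < n, a < m)
    (partial c i (theta_comp theta e a) x -
     \sum_(b < m) connection_coef Gamma c e i a b x * theta_comp theta e b x).

(* Delta_{ab} = nabla_i theta_a omega^{ij} nabla_j theta_b *)
Definition Delta (R : realType) (n m : nat) (M : manifold R n)
    (V : vector_bundle M m) (omega : symplectic_form M) (Gamma : connection V)
    (theta : dual_section V) (c : chart R n M) (e : local_frame m V) (x : M) :
    'M[R]_m :=
  (nabla_theta Gamma theta c e x)^T *m omega_inv omega c x *m
  nabla_theta Gamma theta c e x.

(* omega^{ij} - omega^{ik} nabla_k theta_a Delta^{ab} nabla_l theta_b omega^{lj} *)
Definition dirac_comp (R : realType) (n m : nat) (M : manifold R n)
    (V : vector_bundle M m) (omega : symplectic_form M) (Gamma : connection V)
    (theta : dual_section V) (c : chart R n M) (e : local_frame m V) (x : M) :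
    'M[R]_n :=
  omega_inv omega c x -
  omega_inv omega c x *m nabla_theta Gamma theta c e x *m
  invmx (Delta omega Gamma theta c e x) *m
  (nabla_theta Gamma theta c e x)^T *m omega_inv omega c x.

Definition poisson (R : realType) (n : nat) (M : manifold R n)
    (omega : symplectic_form M) (f g : M -> R) (x : M) : R :=
  bracket (omega_inv omega) f g x.

Definition Delta0 (R : realType) (n m : nat) (M : manifold R n)
    (V : vector_bundle M m) (omega : symplectic_form M)
    (theta : dual_section V) (e : local_frame m V) (x : M) : 'M[R]_m :=
  \matrix_(a < m, b < m)
    poisson omega (theta_comp theta e a) (theta_comp theta e b) x.

Definition conventional_dirac (R : realType) (n m : nat) (M : manifold R n)
    (V : vector_bundle M m) (omega : symplectic_form M)
    (theta : dual_section V) (e : local_frame m V) (f g : M -> R) (x : M) : R :=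
  poisson omega f g x -
  \sum_(a < m) \sum_(b < m)
    poisson omega f (theta_comp theta e a) x *
    invmx (Delta0 omega theta e x) a b *
    poisson omega (theta_comp theta e b) g x.

(* Main.v *)
Require Import Defs.
From HB Require Import structures.
From mathcomp Require Import all_boot all_order all_algebra.
From mathcomp Require Import all_classical all_reals all_analysis.
From mathcomp Require Import ring lra.
Local Open Scope classical_set_scope.
Local Open Scope ring_scope.

(** In a chart and a frame write [P] for the inverse of [omega] and
    [A = (nabla_i theta_a)], so that [D = P - P A Delta^-1 A^T P].  A change of
    frame multiplies [A] by an invertible matrix, which cancels in [D].
    Identically on [M] one has [D A = 0], [A^T D = 0] and
    [D omega D = D].  Differentiating these, with [B = P A Delta^-1],
      [dD = - D (d omega) D - D (dA) B^T - B (dA)^T D],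
    and the cyclic sum of [D^il d_l D^jk] splits into a term that vanishes
    because [omega] is closed and terms
    [(D^il D^jp - D^jl D^ip) (d_l A_pa) B^ka].  At a point of [Sigma],
    [d_l A_pa = d_l d_p theta_a - Gamma^b_pa d_l theta_b]; the first summand is
    symmetric in [l, p], and the second is killed by [D] since
    [d_l theta_b = A_lb] there. *)

Set Implicit Arguments.
Unset Strict Implicit.
Unset Printing Implicit Defensive.

Import Order.TTheory GRing.Theory Num.Theory.
Import numFieldNormedType.Exports.

(** * Smooth functions on open subsets of R^n *)

Local Notation "''d_' i f" := (fun p => derive f p (delta_mx 0 i))
  (at level 10, i at level 2, f at next level, format "''d_' i  f").

(** Differentiating the three identities replaces differentiating [Delta^-1]: they determine [dD] as
    soon as [D] is known to be differentiable, and this follows from the smoothness of [D], hence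
    ultimately from Cramer's rule. The same smoothness makes the inner bracket of the Jacobi
    identity differentiable. Off [Sigma] the part of [d_l A_pa] antisymmetric in [l, p] also
    contains the curvature of [Gamma] applied to [theta], which is why the identity is claimed
    modulo [theta] only. Charts and frames are local, whereas functions and sections are total with
    arbitrary values elsewhere; so every identity that is to be differentiated is first established
    on a neighbourhood, as an equality of germs. *)

Lemma near_eq_differentiable (R : numFieldType) (V W : normedModType R)
    (f g : V -> W) (a : V) :
  (\near a, f a = g a) -> differentiable f a -> differentiable g a.
Proof.
move=> fg df; have [cdf eqf] := (diff_locallyP _ _).1 df.
have eqg : g \o shift a = cst (g a) + 'd f a +o_ 0 id.
  apply/eqaddoP => e e0; move/eqaddoP: eqf => /(_ e e0).
  have fg0 : \forall h \near 0, f (h + a) = g (h + a).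
    have : (h + a) @[h --> (0 : V)] --> 0 + a.
      by apply: cvgD; [exact: cvg_id|exact: cvg_cst].
    by rewrite add0r => /(_ _ fg).
  apply: filter_app; near=> h.
  by rewrite !fctE/= (nbhs_singleton fg) (near fg0 h).
have dfg : 'd g a = 'd f a :> (V -> W) by exact: diff_unique.
by apply/diff_locallyP; rewrite dfg.
Unshelve. all: by end_near. Qed.

Section IterPartial.
Variables (R : realType) (n : nat).
Implicit Types (f g : 'rV[R]_n -> R) (s : seq 'I_n) (U : set 'rV[R]_n).

(** [iter_partial] exposes the outermost derivative; the inductions below need the innermost one, so
    that the hypothesis applies to the function ['d_i f]. *)
Lemma iter_partial_rcons s i f :
  iter_partial (rcons s i) f = iter_partial s ('d_i f).
Proof. exact: foldr_rcons. Qed.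

(** Two functions with the same germ at [p] have the same germ at every nearby point ([near_join]),
    so the agreement survives each derivative. *)
Lemma near_eq_iter_partial s f g (p : 'rV[R]_n) : (\near p, f p = g p) ->
  \near p, iter_partial s f p = iter_partial s g p.
Proof.
move=> fg; elim: s => //= i s /near_join; apply: filterS => q.
exact: near_eq_derive.
Qed.

(** Allows a different representative [g] near each point; this is what later glues components
    computed in different frames. *)
Lemma smooth_on_local U f :
  (forall p, U p -> exists g, (\near p, g p = f p) /\
     exists2 V : set 'rV[R]_n, V p & smooth_on V g) ->
  smooth_on U f.
Proof.
move=> h s p /h[g [gf [V Vp sg]]].
exact: near_eq_differentiable (near_eq_iter_partial s gf) (sg s p Vp).
Qed.

Lemma smooth_onS U V f : V `<=` U -> smooth_on U f -> smooth_on V f.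
Proof. by move=> VU sf s p /VU; exact: sf. Qed.

Lemma smooth_on_differentiable U f p :
  smooth_on U f -> U p -> differentiable f p.
Proof. by move=> /(_ [::] p); exact. Qed.

Lemma smooth_on_partial U f i : smooth_on U f -> smooth_on U ('d_i f).
Proof. by move=> sf s p Up; rewrite -iter_partial_rcons; exact: sf. Qed.

(** Smoothness graded by order. One derivative of a product is a sum of products, so induction on
    the list of derivatives does not go through directly; induction on [k] for all functions at once
    does. Order 0 means differentiable, not merely continuous. *)
Definition Ck k U f := forall s p, (size s <= k)%N -> U p ->
  differentiable (iter_partial s f) p.

Lemma smooth_onP U f : smooth_on U f <-> forall k, Ck k U f.
Proof.
split=> [sf k s p _|Cf s p]; first exact: sf.
exact: (Cf (size s) s p (leqnn _)).
Qed.

Lemma Ck0 U f : Ck 0 U f <-> forall p, U p -> differentiable f p.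
Proof.
split=> [Cf p|df [|//] p _]; last exact: df.
exact: (Cf [::]).
Qed.

Lemma CkS k U f : Ck k.+1 U f <->
  (forall p, U p -> differentiable f p) /\ forall i, Ck k U ('d_i f).
Proof.
split=> [Cf|[df Cdf] s p].
  split=> [p|i s p ks]; first exact: (Cf [::]).
  by rewrite -iter_partial_rcons; apply: Cf; rewrite size_rcons.
case/lastP: s => [|s i]; first by move=> _; exact: df.
by rewrite size_rcons ltnS iter_partial_rcons => ks; exact: Cdf.
Qed.

Lemma CkW k U f : Ck k.+1 U f -> Ck k U f.
Proof. by move=> Cf s p ks; apply: Cf; exact: leqW. Qed.

Lemma Ck_diff k U f p : Ck k U f -> U p -> differentiable f p.
Proof. by move=> /(_ [::] p); exact. Qed.

Lemma Ck_eq k U f g : open U -> (forall p, U p -> f p = g p) ->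
  Ck k U f -> Ck k U g.
Proof.
move=> oU fg Cf s p ks Up; apply: near_eq_differentiable (Cf s p ks Up).
apply: near_eq_iter_partial; near=> q; apply: fg; near: q.
exact: open_nbhs_nbhs.
Unshelve. all: by end_near. Qed.

Lemma Ck_cst k U (a : R) : open U -> Ck k U (fun=> a).
Proof.
move=> oU; elim: k a => [|k IH] a; first exact/Ck0.
apply/CkS; split=> // i; apply: Ck_eq (IH 0) => // p Up.
by rewrite derive_cst.
Qed.

Lemma Ck_add k U f g : open U -> Ck k U f -> Ck k U g ->
  Ck k U (fun p => f p + g p).
Proof.
move=> oU; elim: k f g => [|k IH] f g.
  move=> /Ck0 df /Ck0 dg; apply/Ck0 => p Up.
  by apply: differentiableD; [exact: df|exact: dg].
move=> /CkS[df Cf] /CkS[dg Cg]; apply/CkS; split=> [p Up|i].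
  by apply: differentiableD; [exact: df|exact: dg].
apply: Ck_eq (IH _ _ (Cf i) (Cg i)) => // p Up.
by rewrite -deriveD //; apply: diff_derivable; [exact: df|exact: dg].
Qed.

Lemma Ck_mul k U f g : open U -> Ck k U f -> Ck k U g ->
  Ck k U (fun p => f p * g p).
Proof.
move=> oU; elim: k f g => [|k IH] f g.
  move=> /Ck0 df /Ck0 dg; apply/Ck0 => p Up.
  by apply: differentiableM; [exact: df|exact: dg].
move=> Cf Cg; apply/CkS; split=> [p Up|i].
  by apply: differentiableM; apply: Ck_diff; eassumption.
apply: (@Ck_eq _ _ (fun p => f p * 'd_i g p + g p * 'd_i f p)) => //.
  by move=> p Up; apply/esym/(@deriveM _ _ f g); apply: diff_derivable;
     apply: Ck_diff; eassumption.
have [_ Cdf] := (CkS _ _ _).1 Cf; have [_ Cdg] := (CkS _ _ _).1 Cg.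
by apply: Ck_add => //; apply: IH => //; exact: CkW.
Qed.

(** Here [f] stays fixed in the induction: the derivative of [1/f] is [-(1/f)^2 f'], and the
    induction hypothesis already gives [1/f] at order [k]. *)
Lemma Ck_inv k U f : open U -> (forall p, U p -> f p != 0) -> Ck k U f ->
  Ck k U (fun p => (f p)^-1).
Proof.
move=> oU f0; elim: k => [|k IH].
  move=> /Ck0 df; apply/Ck0 => p Up.
  by apply: differentiableV; [exact: df|exact: f0].
move=> Cf; apply/CkS; split=> [p Up|i].
  by apply: differentiableV; [apply: Ck_diff; eassumption|exact: f0].
have [_ Cdf] := (CkS _ _ _).1 Cf; have Cv := IH (CkW Cf).
apply: (@Ck_eq _ _ (fun p => (-1 * ((f p)^-1 * (f p)^-1)) * 'd_i f p)) => //.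
  move=> p Up; rewrite mulN1r -invfM -expr2.
  apply/esym/(@deriveV _ _ f); first exact: f0.
  by apply: diff_derivable; apply: Ck_diff; eassumption.
by repeat apply: Ck_mul => //; exact: Ck_cst.
Qed.

End IterPartial.

Lemma differentiable_rV (R : numFieldType) (V : normedModType R) (m : nat)
    (phi : V -> 'rV[R]_m) (p : V) :
  (forall j, differentiable (fun q => phi q 0 j) p) -> differentiable phi p.
Proof.
move=> dphi.
have -> : phi = \sum_(j < m) (fun q => phi q 0 j *: delta_mx 0 j).
  by apply/funext => q; rewrite fct_sumE [LHS]row_sum_delta.
by apply: differentiable_sum => j; exact: differentiableZl.
Qed.

(** * Closure of smooth functions and matrices under algebraic operations *)

Section SmoothOn.
Variables (R : realType) (n : nat) (U : set 'rV[R]_n).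
Hypothesis oU : open U.
Implicit Types f g : 'rV[R]_n -> R.

Lemma smooth_on_eq f g : (forall p, U p -> f p = g p) ->
  smooth_on U f -> smooth_on U g.
Proof.
by move=> fg /smooth_onP sf; apply/smooth_onP => k; exact: Ck_eq (sf k).
Qed.

Lemma smooth_on_cst (a : R) : smooth_on U (fun=> a).
Proof. by apply/smooth_onP => k; exact: Ck_cst. Qed.

Lemma smooth_on_add f g : smooth_on U f -> smooth_on U g ->
  smooth_on U (fun p => f p + g p).
Proof.
by move=> /smooth_onP sf /smooth_onP sg; apply/smooth_onP => k; exact: Ck_add.
Qed.

Lemma smooth_on_mul f g : smooth_on U f -> smooth_on U g ->
  smooth_on U (fun p => f p * g p).
Proof.
by move=> /smooth_onP sf /smooth_onP sg; apply/smooth_onP => k; exact: Ck_mul.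
Qed.

Lemma smooth_on_opp f : smooth_on U f -> smooth_on U (fun p => - f p).
Proof.
move=> sf; apply: smooth_on_eq (smooth_on_mul (smooth_on_cst (-1)) sf).
by move=> p _; rewrite mulN1r.
Qed.

Lemma smooth_on_sub f g : smooth_on U f -> smooth_on U g ->
  smooth_on U (fun p => f p - g p).
Proof. by move=> sf sg; apply: smooth_on_add => //; exact: smooth_on_opp. Qed.

Lemma smooth_on_inv f : (forall p, U p -> f p != 0) -> smooth_on U f ->
  smooth_on U (fun p => (f p)^-1).
Proof. by move=> f0 /smooth_onP sf; apply/smooth_onP => k; exact: Ck_inv. Qed.

Lemma smooth_on_sum (I : Type) (r : seq I) (P : pred I)
    (F : I -> 'rV[R]_n -> R) :
  (forall i, P i -> smooth_on U (F i)) ->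
  smooth_on U (fun p => \sum_(i <- r | P i) F i p).
Proof.
move=> sF; elim: r => [|i r IH].
  by under eq_fun do rewrite big_nil; exact: smooth_on_cst.
case: (boolP (P i)) => [Pi|/negPf Pi]; last first.
  by under eq_fun do rewrite big_cons Pi.
under eq_fun do rewrite big_cons Pi.
by apply: smooth_on_add => //; exact: sF.
Qed.

Lemma smooth_on_prod (I : Type) (r : seq I) (P : pred I)
    (F : I -> 'rV[R]_n -> R) :
  (forall i, P i -> smooth_on U (F i)) ->
  smooth_on U (fun p => \prod_(i <- r | P i) F i p).
Proof.
move=> sF; elim: r => [|i r IH].
  by under eq_fun do rewrite big_nil; exact: smooth_on_cst.
case: (boolP (P i)) => [Pi|/negPf Pi]; last first.
  by under eq_fun do rewrite big_cons Pi.
under eq_fun do rewrite big_cons Pi.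
by apply: smooth_on_mul => //; exact: sF.
Qed.

Definition smooth_mx (a b : nat) (X : 'rV[R]_n -> 'M[R]_(a, b)) :=
  forall i j, smooth_on U (fun p => X p i j).

Lemma smooth_mx_tr a b (X : 'rV[R]_n -> 'M[R]_(a, b)) :
  smooth_mx X -> smooth_mx (fun p => (X p)^T).
Proof. by move=> sX i j; under eq_fun do rewrite mxE; exact: sX. Qed.

Lemma smooth_mx_sub a b (X Y : 'rV[R]_n -> 'M[R]_(a, b)) :
  smooth_mx X -> smooth_mx Y -> smooth_mx (fun p => X p - Y p).
Proof.
by move=> sX sY i j; under eq_fun do rewrite !mxE; exact: smooth_on_sub.
Qed.

Lemma smooth_mx_mul a b c (X : 'rV[R]_n -> 'M[R]_(a, b))
    (Y : 'rV[R]_n -> 'M[R]_(b, c)) :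
  smooth_mx X -> smooth_mx Y -> smooth_mx (fun p => X p *m Y p).
Proof.
move=> sX sY i j; under eq_fun do rewrite mxE.
by apply: smooth_on_sum => k _; exact: smooth_on_mul.
Qed.

Lemma smooth_on_det a (X : 'rV[R]_n -> 'M[R]_a) :
  smooth_mx X -> smooth_on U (fun p => \det (X p)).
Proof.
move=> sX; apply: smooth_on_sum => s _; apply: smooth_on_mul.
  exact: smooth_on_cst.
by apply: smooth_on_prod.
Qed.

(** Cramer's rule: the entries of the adjugate are polynomial in those of [X], and the determinant
    does not vanish on [U]. *)
Lemma smooth_mx_inv a (X : 'rV[R]_n -> 'M[R]_a) :
  (forall p, U p -> X p \in unitmx) -> smooth_mx X ->
  smooth_mx (fun p => invmx (X p)).
Proof.
move=> uX sX i j.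
apply: (@smooth_on_eq (fun p => (\det (X p))^-1 * (\adj (X p)) i j)).
  by move=> p Up; rewrite /invmx uX // [RHS]mxE.
apply: smooth_on_mul.
  apply: smooth_on_inv; last exact: smooth_on_det.
  by move=> p /uX; rewrite unitmxE unitfE.
under eq_fun do rewrite mxE.
apply: smooth_on_mul; first exact: smooth_on_cst.
by apply: smooth_on_det => k l; under eq_fun do rewrite !mxE; exact: sX.
Qed.

End SmoothOn.

(** * The chain rule and smoothness of composites *)

Section ChainRule.
Variables (R : realType) (n m : nat).
Implicit Types (phi : 'rV[R]_n -> 'rV[R]_m) (f : 'rV[R]_m -> R).

Lemma jacobian_coord phi p i j : differentiable phi p ->
  jacobian phi p i j = 'd_i (fun q => phi q 0 j) p.
Proof.
move=> dphi; rewrite -[RHS](_ : ('D_(delta_mx 0 i) phi p) 0 j = _).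
  by rewrite deriveEjacobian // -rowE [RHS]mxE.
by rewrite derive_mx ?mxE //; exact: diff_derivable.
Qed.

Lemma derive_comp_rV phi f p i :
  differentiable phi p -> differentiable f (phi p) ->
  'd_i (fun q => f (phi q)) p = \sum_j jacobian phi p i j * 'd_j f (phi p).
Proof.
move=> dphi df; rewrite -[LHS]/(derive (f \o phi) p (delta_mx 0 i)).
rewrite deriveE; last exact: differentiable_comp.
rewrite diff_comp //= -(deriveE _ dphi) deriveEjacobian // -rowE.
rewrite [X in 'd f _ X]row_sum_delta linear_sum; apply: eq_bigr => j _.
by rewrite linearZ /= mxE deriveE.
Qed.

(** The chain rule writes a first derivative of the composite as a sum of products of derivatives of
    [phi] with the composites of ['d_j f] and [phi]. The induction on the order ranges over all [f]
    smooth to every order, a class that contains ['d_j f]. *)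
Lemma smooth_on_comp (U : set 'rV[R]_n) (V : set 'rV[R]_m) phi f :
  open U -> (forall p, U p -> V (phi p)) ->
  (forall j, smooth_on U (fun p => phi p 0 j)) -> smooth_on V f ->
  smooth_on U (fun p => f (phi p)).
Proof.
move=> oU UV sphi /smooth_onP Cf; apply/smooth_onP => k.
have dphi p : U p -> differentiable phi p.
  move=> Up; apply: differentiable_rV => j.
  exact: smooth_on_differentiable Up.
elim: k f Cf => [|k IH] f Cf.
  apply/Ck0 => p Up; apply: (differentiable_comp (g := f)); first exact: dphi.
  exact: Ck_diff (Cf 0%N) (UV _ Up).
apply/CkS; split=> [p Up|i].
  apply: (differentiable_comp (g := f)); first exact: dphi.
  exact: Ck_diff (Cf 0%N) (UV _ Up).
apply: (@Ck_eq _ _ _ _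
  (fun p => \sum_j 'd_i (fun q => phi q 0 j) p * 'd_j f (phi p))) => //.
  move=> p Up; rewrite [RHS]derive_comp_rV; last 2 first.
  - exact: dphi.
  - exact: Ck_diff (Cf 0%N) (UV _ Up).
  by apply: eq_bigr => j _; rewrite jacobian_coord //; exact: dphi.
have Ck_sum (r : seq 'I_m) (F : 'I_m -> 'rV[R]_n -> R) :
    (forall j, Ck k U (F j)) -> Ck k U (fun p => \sum_(j <- r) F j p).
  move=> CF; elim: r => [|j r IHr].
    by under eq_fun do rewrite big_nil; exact: Ck_cst.
  under eq_fun do rewrite big_cons.
  by apply: (Ck_add oU (CF j)).
apply: Ck_sum => j; apply: Ck_mul => //.
  exact: ((smooth_onP _ _).1 (smooth_on_partial i (sphi j)) k).
by apply: (IH ('d_j f)) => l; have [_] := (CkS _ _ _).1 (Cf l.+1).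
Qed.

End ChainRule.

(** * Symmetry of mixed derivatives *)

Section Schwarz.
Variables (R : realType) (V : normedModType R).
Implicit Types (f : V -> R) (p u v : V).

Lemma differentiable_approx f p (e : R) : differentiable f p -> 0 < e ->
  exists2 d : R, 0 < d & forall y, `|y| < d ->
    `|f (y + p) - f p - 'd f p y| <= e * `|y|.
Proof.
move=> /diff_locallyP[_ /eqaddoP h] e0; have := h e e0.
move=> /nbhs_normP[d /= d0 hd]; exists d => // y yd.
have /= := hd y; rewrite !fctE /= sub0r normrN => /(_ yd).
by rewrite opprD addrA.
Qed.

(* The mixed second difference of [f] over the steps [h *: u] and [h *: v] is
   [h ^+ 2] times the mixed derivative up to [o(h ^+ 2)]; its symmetry in [u]
   and [v] gives Schwarz's theorem. *)
Lemma second_difference f p u v (e : R) :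
  (\forall q \near p, differentiable f q) ->
  differentiable (fun q => 'D_u f q) p -> 0 < e ->
  \forall h \near (0 : R)^'+,
    `|f (h *: u + h *: v + p) - f (h *: u + p) - f (h *: v + p) + f p -
      h ^+ 2 * 'D_v (fun q => 'D_u f q) p| <= e * h ^+ 2.
Proof.
move=> df ddf e0; set L := 'd (fun q => 'D_u f q) p.
(* The two remainders estimated below add up to at most [e / k * (2 |u| + |v|) * h]; the extra [1]
   keeps [k] positive when [u] and [v] vanish. *)
pose k := 2 * `|u| + `|v| + 1.
have k0 : 0 < k by rewrite ltr_wpDl // addr_ge0 // mulr_ge0.
have [d d0 hd] := differentiable_approx ddf (divr_gt0 e0 k0).
move/nbhs_normP: df => [r /= r0 hr].
(* For steps [s, t <= h < b] the displacement [s *: u + t *: v] has norm at most [h * k], hence lies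
   within both radii [r] and [d]. *)
pose b := Num.min r d / k.
have b0 : 0 < b by rewrite divr_gt0 // lt_min r0.
near=> h.
have h0 : 0 < h by near: h; exact: nbhs_right_gt.
have hb : h < b by near: h; exact: nbhs_right_lt.
have small s t : 0 <= s -> s <= h -> 0 <= t -> t <= h ->
    `|s *: u + t *: v| < Num.min r d.
  move=> s0 sh t0 th.
  rewrite (le_lt_trans (ler_normD _ _)) // !normrZ !ger0_norm //.
  have : h * k < Num.min r d by rewrite -ltr_pdivlMr.
  apply: le_lt_trans; rewrite /k.
  have := ler_wpM2r (normr_ge0 u) sh; have := ler_wpM2r (normr_ge0 v) th.
  have := mulr_ge0 (ltW h0) (normr_ge0 u).
  by move: h0; lra.
have dfst s t : 0 <= s -> s <= h -> 0 <= t -> t <= h ->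
    differentiable f (s *: u + t *: v + p).
  move=> s0 sh t0 th; apply: hr => /=; rewrite opprD addrCA subrr addr0 normrN.
  by have := small s t s0 sh t0 th; rewrite lt_min => /andP[].
(* The second difference is [g h - g 0]. The mean value theorem in the [u] direction turns it into
   [h * g' c], after which only the first-order expansion of ['D_u f] at [p] is needed. The term
   [0 *: v] gives both summands the shape treated by [dline]. *)
pose g (s : R) := f (s *: u + h *: v + p) - f (s *: u + 0 *: v + p).
pose g' (s : R) := 'D_u f (s *: u + h *: v + p) - 'D_u f (s *: u + 0 *: v + p).
have dline (s t : R) : 0 <= s -> s <= h -> 0 <= t -> t <= h ->
    is_derive s 1 (fun s => f (s *: u + t *: v + p))
      ('D_u f (s *: u + t *: v + p)).
  move=> s0 sh t0 th; set q := t *: v + p.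
  have qE (x : R) : x *: u + t *: v + p = x *: u + q by rewrite -addrA.
  have -> : (fun s => f (s *: u + t *: v + p)) = f \o (fun s => s *: u + q).
    by apply/funext => x /=; rewrite qE.
  have da : is_diff s (fun s : R => s *: u + q) (fun x => x *: u).
    have -> : (fun s : R => s *: u + q) = ( *:%R ^~ u) + cst q by [].
    by apply: is_diff_eq; rewrite addr0.
  have dl : differentiable (fun s : R => s *: u + q) s.
    exact: (@ex_diff _ _ _ _ _ _ _ da).
  have dq : differentiable f (s *: u + q) by rewrite -qE; exact: dfst.
  apply: DeriveDef; first exact/diff_derivable/differentiable_comp.
  rewrite deriveE; last exact: differentiable_comp.
  rewrite diff_comp //.
  by rewrite /= diff_val scale1r -deriveE // qE.
have dg s : 0 <= s -> s <= h -> is_derive s 1 g (g' s).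
  by move=> s0 sh; apply: is_deriveB; apply: dline => //; exact: ltW.
have cg : {within `[0, h], continuous g}.
  apply: continuous_in_subspaceT => s; rewrite inE /= in_itv /= => /andP[s0 sh].
  by apply/differentiable_continuous/derivable1_diffP; have [] := dg s s0 sh.
have [c] := MVT h0 (fun x xh => dg x (ltW (andP xh).1) (ltW (andP xh).2)) cg.
rewrite in_itv /= subr0 => /andP[/ltW c0 /ltW ch] gE.
have near_p (s t : R) : 0 <= s -> s <= h -> 0 <= t -> t <= h ->
    `|'D_u f (s *: u + t *: v + p) - 'D_u f p - L (s *: u + t *: v)| <=
    e / k * (s * `|u| + t * `|v|).
  move=> s0 sh t0 th; have := small s t s0 sh t0 th; rewrite lt_min => /andP[_].
  move=> /hd /le_trans -> //.
  rewrite ler_wpM2l ?divr_ge0 // ?(ltW e0) ?(ltW k0) //.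
  by rewrite (le_trans (ler_normD _ _)) // !normrZ !ger0_norm.
(* In the difference of the expansions at [(c, h)] and [(c, 0)] the contributions [c * L u] cancel,
   leaving [h] times the mixed derivative. *)
have {near_p} := lerD (near_p c h c0 ch (ltW h0) (lexx h))
  (near_p c 0 c0 ch (lexx 0) (ltW h0)).
move=> /(le_trans (ler_normB _ _)) est.
have Luv (t : R) :
    L (c *: u + t *: v) = c * L u + t * 'D_v (fun q => 'D_u f q) p.
  by rewrite linearD !linearZ /= (deriveE v ddf).
rewrite !Luv in est.
have gE' : f (h *: u + h *: v + p) - f (h *: u + p) - f (h *: v + p) + f p =
    g h - g 0.
  by rewrite /g !scale0r !addr0 !add0r; ring.
rewrite gE' gE.
have -> : g' c * h - h ^+ 2 * 'D_v (fun q => 'D_u f q) p =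
  h * (g' c - h * 'D_v (fun q => 'D_u f q) p) by ring.
rewrite normrM (gtr0_norm h0) expr2 mulrCA ler_pM2l //.
have -> : g' c - h * 'D_v (fun q => 'D_u f q) p = 
   'D_u f (c *: u + h *: v + p) - 'D_u f p -
      (c * L u + h * 'D_v (fun q => 'D_u f q) p) -
   ('D_u f (c *: u + 0 *: v + p) - 'D_u f p -
      (c * L u + 0 * 'D_v (fun q => 'D_u f q) p)) by rewrite /g'; ring.
apply: le_trans est _.
rewrite -mulrDr -mulrA ler_pM2l // ler_pdivrMl // mul0r addr0 /k.
have -> : (2 * `|u| + `|v| + 1) * h = 2 * (h * `|u|) + h * `|v| + h by ring.
by have := ler_wpM2r (normr_ge0 u) ch; move: h0; lra.
Unshelve. all: by end_near. Qed.

Lemma derive_comm f p u v :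
  (\forall q \near p, differentiable f q) ->
  differentiable (fun q => 'D_u f q) p ->
  differentiable (fun q => 'D_v f q) p ->
  'D_v (fun q => 'D_u f q) p = 'D_u (fun q => 'D_v f q) p.
Proof.
move=> df du dv; set A := LHS; set B := RHS.
apply/eqP; rewrite -subr_eq0 -normr_le0; apply/ler_addgt0Pl => e e0.
rewrite addr0; have e2 : 0 < e / 2 by rewrite divr_gt0.
(* One step [h > 0] at which both estimates hold suffices: subtracting them and dividing by [h ^+ 2]
   gives [|A - B| <= e]. *)
have F : ProperFilter (0 : R)^'+ by typeclasses eauto.
have hh := @filterI _ _ F _ _ (second_difference v df du e2)
  (second_difference u df dv e2).
have [h [h0 [huv hvu]]] :=
  @filter_ex _ _ F _ (@filterI _ _ F _ _ (nbhs_right_gt (0 : R)) hh).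
rewrite /= in h0 huv hvu.
have := le_trans (ler_normB _ _) (lerD hvu huv).
rewrite -/A -/B.
rewrite [h *: v + _]addrC (_ : _ - _ = h ^+ 2 * (A - B)); last by ring.
rewrite -mulrDl -splitr normrM gtr0_norm ?exprn_gt0 // mulrC ler_pM2r //.
by rewrite exprn_gt0.
Qed.

End Schwarz.

(** * Functions on a manifold in charts *)

Section Charts.
Variables (R : realType) (n : nat) (M : manifold R n).
Implicit Types (c : chart R n M) (x y : M) (U W : set M) (f g : M -> R).

Lemma chart_img_inv c U p : (c @` (U `&` chart_dom c)) p ->
  [/\ U (chart_inv c p), chart_dom c (chart_inv c p) & c (chart_inv c p) = p].
Proof. by move=> [x [Ux cx] <-]; rewrite chart_mapK. Qed.

Lemma near_chart_inv c x (P : M -> Prop) : chart_dom c x ->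
  (\forall y \near x, P y) -> \forall p \near c x, P (chart_inv c p).
Proof.
move=> cx xP; have := chart_inv_continuous cx; rewrite /prop_for /continuous_at.
by rewrite chart_mapK //; apply.
Qed.

Lemma near_chart_img c x : chart_dom c x ->
  \forall p \near c x, (c @` chart_dom c) p.
Proof.
move=> cx; apply: open_nbhs_nbhs; split; first exact: chart_img_open.
by exists x.
Qed.

Lemma open_chart_img c U : open U -> open (c @` (U `&` chart_dom c)).
Proof.
move=> oU; rewrite openE => _ [x [Ux cx] <-].
have xU : \forall y \near x, U y by exact: open_nbhs_nbhs.
apply: filterS2 (near_chart_img cx) (near_chart_inv cx xU).
move=> p [y cy <-]; rewrite chart_mapK // => Uy.
by exists y.
Qed.

Lemma partial_near_eq c i f g x : chart_dom c x ->
  (\forall y \near x, f y = g y) -> partial c i f x = partial c i g x.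
Proof.
by move=> cx fg; apply: near_eq_derive; exact: near_chart_inv fg.
Qed.

Lemma partial_open_eq c i f g U x : open U -> U x -> chart_dom c x ->
  (forall y, U y -> f y = g y) -> partial c i f x = partial c i g x.
Proof.
move=> oU Ux cx fg; apply: partial_near_eq => //.
by apply: filterS fg _; exact: open_nbhs_nbhs.
Qed.

Lemma partial_cst c i a x : partial c i (fun=> a) x = 0.
Proof. exact: derive_cst. Qed.

Definition differentiable_in c f x :=
  differentiable (fun p => f (chart_inv c p)) (c x).

Lemma smooth_fun_on_differentiable c f U x : atlas c -> smooth_fun_on U f ->
  U x -> chart_dom c x -> differentiable_in c f x.
Proof.
move=> ac sf Ux cx; apply: smooth_on_differentiable (sf c ac) _.
by exists x.
Qed.

Lemma partial_mul c i f g x : chart_dom c x ->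
  differentiable_in c f x -> differentiable_in c g x ->
  partial c i (fun y => f y * g y) x =
    f x * partial c i g x + g x * partial c i f x.
Proof.
move=> cx /(@diff_derivable _ _ _ _ _ (delta_mx 0 i)) df.
move=> /(@diff_derivable _ _ _ _ _ (delta_mx 0 i)) dg.
by have := deriveM df dg; rewrite chart_mapK.
Qed.

Lemma partial_sum k c i (F : 'I_k -> M -> R) x :
  (forall j, differentiable_in c (F j) x) ->
  partial c i (fun y => \sum_(j < k) F j y) x =
    \sum_(j < k) partial c i (F j) x.
Proof.
move=> dF.
have {}dF j : derivable (fun p => F j (chart_inv c p)) (c x) (delta_mx 0 i).
  exact: diff_derivable (dF j).
rewrite /partial -(derive_sum dF); congr derive; apply/funext => p.
by rewrite fct_sumE.
Qed.

Lemma smooth_on_sub_chart c f U W : W `<=` U ->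
  smooth_on (c @` (U `&` chart_dom c)) (fun p => f (chart_inv c p)) ->
  smooth_on (c @` (W `&` chart_dom c)) (fun p => f (chart_inv c p)).
Proof. by move=> WU; apply: smooth_onS => _ [x [/WU Ux cx] <-]; exists x. Qed.

Lemma smooth_fun_onS U W f : W `<=` U -> smooth_fun_on U f -> smooth_fun_on W f.
Proof. by move=> WU sf c ac; apply: smooth_on_sub_chart WU (sf c ac). Qed.

Lemma smooth_fun_on_eq U f g : open U -> (forall y, U y -> f y = g y) ->
  smooth_fun_on U f -> smooth_fun_on U g.
Proof.
move=> oU fg sf c ac; apply: smooth_on_eq (sf c ac).
  exact: open_chart_img.
by move=> p /chart_img_inv[Up _ _]; exact: fg.
Qed.

Lemma smooth_fun_on_cst U (a : R) : open U -> smooth_fun_on U (fun=> a).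
Proof. by move=> oU c ac; apply: smooth_on_cst; exact: open_chart_img. Qed.

Lemma smooth_fun_on_add U f g : open U -> smooth_fun_on U f ->
  smooth_fun_on U g -> smooth_fun_on U (fun y => f y + g y).
Proof.
move=> oU sf sg c ac.
by apply: smooth_on_add (sf c ac) (sg c ac); exact: open_chart_img.
Qed.

Lemma smooth_fun_on_mul U f g : open U -> smooth_fun_on U f ->
  smooth_fun_on U g -> smooth_fun_on U (fun y => f y * g y).
Proof.
move=> oU sf sg c ac.
by apply: smooth_on_mul (sf c ac) (sg c ac); exact: open_chart_img.
Qed.

Lemma smooth_fun_on_local U f :
  (forall x, U x -> exists g W, [/\ open W, W x, smooth_fun_on W g &
     forall y, W y -> g y = f y]) ->
  smooth_fun_on U f.
Proof.
move=> h c ac; apply: smooth_on_local => _ [x [Ux cx] <-].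
have [g [W [oW Wx sg gf]]] := h x Ux.
exists (fun p => g (chart_inv c p)); split.
  have : \forall y \near x, W y by exact: open_nbhs_nbhs.
  by move=> /(near_chart_inv cx); apply: filterS => p; exact: gf.
by exists (c @` (W `&` chart_dom c)); [exists x|exact: sg].
Qed.

Lemma smooth_on_partial_chart c i U f :
  atlas c -> open U -> smooth_fun_on U f ->
  smooth_on (c @` (U `&` chart_dom c)) (fun p => partial c i f (chart_inv c p)).
Proof.
move=> ac oU sf; apply: smooth_on_eq (smooth_on_partial i (sf c ac)).
  exact: open_chart_img.
by move=> p /chart_img_inv[_ _ pE]; rewrite /partial pE.
Qed.

Lemma differentiable_transition c c' x : atlas c -> atlas c' ->
  chart_dom c x -> chart_dom c' x ->
  differentiable (fun p => c' (chart_inv c p)) (c x).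
Proof.
move=> ac ac' cx c'x; apply: differentiable_rV => j.
by apply: smooth_on_differentiable (atlas_smooth ac ac' j) _; exists x.
Qed.

Lemma partial_change c c' i f x : atlas c -> atlas c' ->
  chart_dom c x -> chart_dom c' x -> differentiable_in c' f x ->
  partial c i f x = \sum_j transition_jacobian c c' x i j * partial c' j f x.
Proof.
move=> ac ac' cx c'x df.
pose phi p := c' (chart_inv c p).
have phix : phi (c x) = c' x by rewrite /phi chart_mapK.
transitivity ('d_i (fun p => f (chart_inv c' (phi p))) (c x)).
  apply: near_eq_derive.
  have : \forall y \near x, chart_dom c' y.
    by apply: open_nbhs_nbhs; split=> //; exact: chart_dom_open.
  move=> /(near_chart_inv cx); apply: filterS => p c'p.
  by rewrite /phi chart_mapK.
rewrite (derive_comp_rV (phi := phi) (f := fun p => f (chart_inv c' p))).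
- by rewrite phix.
- exact: differentiable_transition.
- by rewrite phix.
Qed.

(** [smooth_fun_on] asks for smoothness in every chart; inside a single chart domain, composition
    with the transition maps reduces this to that chart. *)
Lemma smooth_fun_on_chart c U f : atlas c -> open U -> U `<=` chart_dom c ->
  smooth_on (c @` (U `&` chart_dom c)) (fun p => f (chart_inv c p)) ->
  smooth_fun_on U f.
Proof.
move=> ac oU Uc sf c' ac'.
have oU' := open_chart_img (c := c') oU.
apply: (@smooth_on_eq _ _ _ _
  (fun p => f (chart_inv c (c (chart_inv c' p))))) => //.
  by move=> p /chart_img_inv[/Uc cp _ _]; rewrite chart_mapK.
apply: (@smooth_on_comp _ _ _ _ _ (fun p => c (chart_inv c' p))
  (fun p => f (chart_inv c p)) oU' _ _ sf).
  move=> p /chart_img_inv[Up _ _]; exists (chart_inv c' p) => //.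
  by split=> //; exact: Uc.
move=> j; apply: smooth_onS (atlas_smooth ac' ac j).
by move=> _ [x [/[dup] Ux /Uc cx c'x] <-]; exists x.
Qed.

End Charts.

(** * Connections *)

Section Connection.
Variables (R : realType) (n m : nat) (M : manifold R n).
Variables (V : vector_bundle M m) (Gamma : connection V).
Implicit Types (c : chart R n M) (e : local_frame m V) (U W : set M).
Implicit Types (s t : forall x, V x).

Lemma smooth_section_on_frame e a : frames e ->
  smooth_section_on (frame_dom e) (fun y => tnth (e y) a).
Proof. by move=> fe e' b fe'; rewrite setIC; exact: frames_smooth. Qed.

Lemma smooth_section_onS U W s : W `<=` U ->
  smooth_section_on U s -> smooth_section_on W s.
Proof.
move=> WU ss e a fe; apply: smooth_fun_onS (ss e a fe).
by move=> x [/WU Ux ex].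
Qed.

Lemma smooth_section_on_scale U (f : M -> R) s : open U ->
  smooth_fun_on U f -> smooth_section_on U s ->
  smooth_section_on U (fun y => f y *: s y).
Proof.
move=> oU sf ss e a fe; have oUe : open (U `&` frame_dom e).
  by apply: openI => //; exact: frame_dom_open.
have sf' : smooth_fun_on (U `&` frame_dom e) f.
  by apply: smooth_fun_onS sf => x [].
apply: smooth_fun_on_eq (smooth_fun_on_mul oUe sf' (ss e a fe)) => //.
by move=> y _; rewrite linearZ.
Qed.

Lemma smooth_section_on_sum U (I : Type) (r : seq I)
    (F : I -> forall x, V x) : open U ->
  (forall i, smooth_section_on U (F i)) ->
  smooth_section_on U (fun y => \sum_(i <- r) F i y).
Proof.
move=> oU sF e a fe; have oUe : open (U `&` frame_dom e).
  by apply: openI => //; exact: frame_dom_open.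
elim: r => [|i r IH].
  apply: smooth_fun_on_eq (smooth_fun_on_cst 0 oUe) => // y _.
  by rewrite big_nil linear0.
apply: smooth_fun_on_eq (smooth_fun_on_add oUe (sF i e a fe) IH) => // y _.
by rewrite big_cons linearD.
Qed.

(** The indicator function of [U] may jump outside [U], but on [U] it is constantly 1, hence smooth
    there with zero derivatives. Multiplied by it, [s] and [t] become equal as total sections. *)
Lemma nabla_local c i U s t x : atlas c -> open U -> U x -> chart_dom c x ->
  smooth_section_on U s -> smooth_section_on U t ->
  (forall y, U y -> s y = t y) -> Gamma c i s x = Gamma c i t x.
Proof.
move=> ac oU Ux cx ss st st_eq.
pose f y : R := (y \in U)%:R.
have f1 y : U y -> f y = 1 by move=> Uy; rewrite /f mem_set.
have sf : smooth_fun_on U f.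
  by apply: smooth_fun_on_eq (smooth_fun_on_cst 1 oU) => // y /f1.
have E u : smooth_section_on U u ->
    Gamma c i (fun y => f y *: u y) x = Gamma c i u x.
  move=> su; rewrite (nabla_leibniz Gamma i ac oU sf su Ux cx) f1 // scale1r.
  rewrite (@partial_open_eq _ _ _ c i f (fun=> 1) U x) //.
  by rewrite partial_cst scale0r add0r.
rewrite -(E s) // -(E t) //.
suff -> : (fun y => f y *: s y) = (fun y => f y *: t y) by [].
apply: functional_extensionality_dep => y.
rewrite /f; case: (boolP (y \in U)) => [/set_mem /st_eq -> //|_].
by rewrite !scale0r.
Qed.

Lemma nabla_sum c i U (I : Type) (r : seq I) (F : I -> forall x, V x) x :
  atlas c -> open U -> U x -> chart_dom c x ->
  (forall j, smooth_section_on U (F j)) ->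
  Gamma c i (fun y => \sum_(j <- r) F j y) x = \sum_(j <- r) Gamma c i (F j) x.
Proof.
move=> ac oU Ux cx sF; elim: r => [|j r IH].
  have s0 : smooth_section_on U (fun y => \sum_(j <- [::]) F j y).
    exact: smooth_section_on_sum.
  (* The derivative of the zero section vanishes by the Leibniz rule with the constant factor 0. *)
  have := nabla_leibniz Gamma i ac oU (smooth_fun_on_cst 0 oU) s0 Ux cx.
  rewrite partial_cst !scale0r addr0 big_nil => <-.
  suff <- : (fun y => 0 *: \sum_(j <- [::]) F j y) =
    (fun y => \sum_(j <- [::]) F j y) by [].
  by apply: functional_extensionality_dep => y; rewrite big_nil scale0r.
rewrite big_cons -IH -(nabla_add Gamma i ac oU (sF j) _ Ux cx).
  suff -> : (fun y => \sum_(k <- j :: r) F k y) =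
    (fun y => F j y + \sum_(k <- r) F k y) by [].
  by apply: functional_extensionality_dep => y; rewrite big_cons.
exact: smooth_section_on_sum.
Qed.

End Connection.

(** * Transformation of the covariant derivatives of theta under changes of chart and frame *)

Section DiracBivector.
Variables (R : realType) (n m : nat) (M : manifold R n).
Variables (omega : symplectic_form M) (V : vector_bundle M m).
Variables (Gamma : connection V) (theta : dual_section V).
Implicit Types (c : chart R n M) (e : local_frame m V) (U W : set M).

Lemma theta_comp_differentiable c e a x : atlas c -> frames e ->
  chart_dom c x -> frame_dom e x ->
  differentiable_in c (theta_comp theta e a) x.
Proof.
move=> ac fe cx ex.
exact: smooth_fun_on_differentiable ac (dual_section_smooth theta a fe) ex cx.
Qed.

(** The connection term without indices, as [theta] applied to the derivative of the frame vector.
    Both transformation laws start from this form, since the axioms of a connection apply to it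
    directly. *)
Lemma nabla_thetaE c e x i a : frame_dom e x ->
  nabla_theta Gamma theta c e x i a =
  partial c i (theta_comp theta e a) x -
  theta x (Gamma c i (fun y => tnth (e y) a) x).
Proof.
move=> ex; rewrite mxE; congr (_ - _).
rewrite [X in theta x X](coord_basis (frame_basis ex) (memvf _)) linear_sum.
by apply: eq_bigr => b _; rewrite linearZ /theta_comp -tnth_nth.
Qed.

Lemma nabla_theta_chart c c' e x : atlas c -> atlas c' -> frames e ->
  chart_dom c x -> chart_dom c' x -> frame_dom e x ->
  nabla_theta Gamma theta c e x =
  transition_jacobian c c' x *m nabla_theta Gamma theta c' e x.
Proof.
move=> ac ac' fe cx c'x ex; apply/matrixP => i a.
rewrite nabla_thetaE // mxE.
under [RHS]eq_bigr do rewrite nabla_thetaE // mulrBr.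
rewrite sumrB; congr (_ - _).
  by apply: partial_change => //; exact: theta_comp_differentiable.
rewrite (nabla_tensor Gamma i ac ac' (frame_dom_open e)
  (smooth_section_on_frame a fe)) // linear_sum.
by apply: eq_bigr => j _; rewrite linearZ.
Qed.

Definition frame_change e e' x : 'M[R]_m :=
  \matrix_(b, a) coord (e x) b (tnth (e' x) a).

(** Write [e'_a] as the sum of [lam b] times [e_b]. The terms [theta_b d_i (lam b)] arise both from
    differentiating [theta(e'_a)] and from the Leibniz rule for [Gamma], and cancel. The expansion
    holds on the overlap only, hence the appeal to [nabla_local]. *)
Lemma nabla_theta_frame c e e' x : atlas c -> frames e -> frames e' ->
  chart_dom c x -> frame_dom e x -> frame_dom e' x ->
  nabla_theta Gamma theta c e' x =
  nabla_theta Gamma theta c e x *m frame_change e e' x.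
Proof.
move=> ac fe fe' cx ex e'x; apply/matrixP => i a.
pose U := frame_dom e `&` frame_dom e'.
have oU : open U by apply: openI; exact: frame_dom_open.
have Ux : U x by [].
pose lam b y := coord (e y) b (tnth (e' y) a).
have slam b : smooth_fun_on U (lam b) by exact: frames_smooth.
have expand y : U y -> tnth (e' y) a = \sum_b lam b y *: tnth (e y) b.
  move=> [ey _]; rewrite [LHS](coord_basis (frame_basis ey) (memvf _)).
  by apply: eq_bigr => b _; rewrite -tnth_nth.
have se b : smooth_section_on U (fun y => tnth (e y) b).
  by apply: smooth_section_onS (smooth_section_on_frame b fe) => y [].
have sle b : smooth_section_on U (fun y => lam b y *: tnth (e y) b).
  exact: smooth_section_on_scale.
have dlam b : differentiable_in c (lam b) x.
  exact: smooth_fun_on_differentiable ac (slam b) Ux cx.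
have dth b : differentiable_in c (theta_comp theta e b) x.
  exact: theta_comp_differentiable.
rewrite nabla_thetaE //.
rewrite (@nabla_local _ _ _ _ _ Gamma c i U _
  (fun y => \sum_b lam b y *: tnth (e y) b) x) //; first last.
- exact: smooth_section_on_sum.
- by apply: smooth_section_onS (smooth_section_on_frame a fe') => y [].
rewrite (nabla_sum Gamma i _ ac oU Ux cx sle).
rewrite (@partial_open_eq _ _ _ c i _
  (fun y => \sum_b lam b y * theta_comp theta e b y) U) //; last first.
  move=> y /expand ey; rewrite /theta_comp ey linear_sum.
  by apply: eq_bigr => b _; rewrite linearZ.
rewrite partial_sum; last first.
  by move=> b; exact: (differentiableM (dlam b) (dth b)).
rewrite linear_sum -sumrB mxE; apply: eq_bigr => b _.
rewrite (nabla_leibniz Gamma i ac oU (slam b) (se b) Ux cx) partial_mul //.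
rewrite nabla_thetaE // mxE linearD !linearZ /=.
rewrite /theta_comp /GRing.scale /= /lam.
by ring.
Qed.

End DiracBivector.

(** * Matrix algebra of the Dirac bivector *)

Section DiracAlgebra.
Variables (R : comUnitRingType) (n m : nat).
Variables (W : 'M[R]_n) (A : 'M[R]_(n, m)).
Hypotheses (uW : W \in unitmx) (skewW : W^T = - W).
Hypothesis uDelta : A^T *m invmx W *m A \in unitmx.

Let P := invmx W.
Let Delta := A^T *m P *m A.
Let D := P - P *m A *m invmx Delta *m A^T *m P.
Let B := P *m A *m invmx Delta.

Lemma trmx_invmx_skew k (X : 'M[R]_k) :
  X \in unitmx -> X^T = - X -> (invmx X)^T = - invmx X.
Proof.
move=> uX sX; apply: (can_inj (mulKmx uX)).
rewrite mulmxN mulmxV // -[X in X *m _]opprK -sX mulNmx.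
by rewrite -trmx_mul mulVmx // trmx1.
Qed.

Lemma dirac_Delta_skew : Delta^T = - Delta.
Proof.
by rewrite /Delta !trmx_mul trmxK trmx_invmx_skew // mulNmx mulmxN mulmxA.
Qed.

Lemma dirac_trB : B^T = invmx Delta *m A^T *m P.
Proof.
rewrite /B !trmx_mul !trmx_invmx_skew ?dirac_Delta_skew //.
by rewrite mulNmx !mulmxN opprK mulmxA.
Qed.

Lemma dirac_skew : D^T = - D.
Proof.
rewrite /D linearB /= !trmx_mul trmxK !trmx_invmx_skew ?dirac_Delta_skew //.
by rewrite !(mulNmx, mulmxN) !opprK !mulmxA opprD opprK.
Qed.

Lemma dirac_mulA : D *m A = 0.
Proof.
rewrite /D mulmxBl -!mulmxA [A^T *m (P *m A)]mulmxA mulVmx // mulmx1.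
by rewrite subrr.
Qed.

Lemma dirac_trA_mul : A^T *m D = 0.
Proof.
apply: trmx_inj.
by rewrite trmx_mul trmxK dirac_skew mulNmx dirac_mulA oppr0 trmx0.
Qed.

(** Since [B^T *m A = 1], the matrix [A *m B^T] is a projector onto the column span of [A], and
    [W *m D] is the complementary one. *)
Lemma dirac_W_mul : W *m D = 1%:M - A *m B^T.
Proof.
by rewrite dirac_trB /D mulmxBr mulmxV // !mulmxA mulmxV // mul1mx.
Qed.

Lemma dirac_mul_W : D *m W = 1%:M - B *m A^T.
Proof. by rewrite /D mulmxBl mulVmx // mulmxKV. Qed.

Lemma dirac_mul_W_mul : D *m W *m D = D.
Proof.
by rewrite dirac_mul_W mulmxBl mul1mx -mulmxA dirac_trA_mul mulmx0 subr0.
Qed.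

End DiracAlgebra.

(* [dW], [dA], [dD] stand for the derivatives of [W], [A], [D] along a vector;
   the hypotheses are the derivatives of [D W D = D], [D A = 0], [A^T D = 0]. *)
Lemma dirac_derivation (R : comUnitRingType) (n m : nat)
    (D W dW dD : 'M[R]_n) (A B dA : 'M[R]_(n, m)) :
  W *m D = 1%:M - A *m B^T -> D *m W = 1%:M - B *m A^T ->
  dD = (dD *m W + D *m dW) *m D + D *m W *m dD ->
  dD *m A + D *m dA = 0 -> dA^T *m D + A^T *m dD = 0 ->
  dD = - (D *m dW *m D) - D *m dA *m B^T - B *m dA^T *m D.
Proof.
move=> WD DW eD /eqP; rewrite addr_eq0 => /eqP eDA.
move=> /eqP; rewrite addrC addr_eq0 => /eqP eAD.
(* [W D = 1 - A B^T] and [dD A = - D dA] trade [dD W D] for [dD] plus a known term, and likewise for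
   [D W dD]. The derivative of [D W D = D] then has [dD] once on the left and twice on the right,
   which determines it. *)
have eW : dD *m W *m D = dD + D *m dA *m B^T.
  by rewrite -mulmxA WD mulmxBr mulmx1 mulmxA eDA mulNmx opprK.
have We : D *m W *m dD = dD + B *m dA^T *m D.
  by rewrite DW [LHS]mulmxBl mul1mx -!mulmxA eAD mulmxN opprK.
have {}eD : dD + (D *m dA *m B^T + D *m dW *m D + B *m dA^T *m D) = 0.
  apply: (addrI dD); rewrite addr0 [RHS]eD mulmxDl eW We.
  by rewrite [in RHS]addrCA !addrA.
apply/eqP; rewrite -!opprD -addr_eq0 -eD; apply/eqP; congr (_ + (_ + _)).
exact: addrC.
Qed.

(** * The cyclic sum as an identity of matrices at one point *)

Section JacobiAlgebra.
Variables (R : comNzRingType) (n m : nat).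
Variables (D : 'M[R]_n) (A B : 'M[R]_(n, m)).
Variables (dD dW : 'I_n -> 'M[R]_n) (dA : 'I_n -> 'M[R]_(n, m)).
Variables (hess : 'I_m -> 'M[R]_n) (G : 'I_n -> 'M[R]_m).
Hypothesis skewD : D^T = - D.
Hypothesis DA0 : D *m A = 0.
Hypothesis dDE : forall l,
  dD l = - (D *m dW l *m D) - D *m dA l *m B^T - B *m (dA l)^T *m D.
Hypothesis dAE : forall l p a,
  dA l p a = hess a l p - \sum_b G p a b * A l b.
Hypothesis hess_sym : forall a, (hess a)^T = hess a.
Hypothesis closedW : forall i j k, dW i j k + dW j k i + dW k i j = 0.

(** For [X] a family of partial derivatives, this is the derivative along the vector [a]. It is used
    with [a = u *m D], the Hamiltonian vector field, for the Dirac bracket, of a function with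
    gradient [u]. *)
Definition contract (k : nat) (a : 'rV[R]_n) (X : 'I_n -> 'M[R]_(n, k)) :=
  \sum_l a 0 l *: X l.

Lemma contractE k (a b : 'rV[R]_n) (X : 'I_n -> 'M[R]_(n, k)) c :
  (b *m contract a X) 0 c = \sum_l \sum_p a 0 l * b 0 p * X l p c.
Proof.
rewrite /contract mulmx_sumr summxE; apply: eq_bigr => l _.
rewrite -scalemxAr !mxE big_distrr /=; apply: eq_bigr => p _.
by rewrite mulrA.
Qed.

(** The only place where [dAE], the form of the derivative of [A] valid on Sigma, is used. The
    connection part contains the factor [a *m D *m A], which is zero. *)
Lemma contract_dA_sym (u v : 'rV[R]_n) :
  v *m D *m contract (u *m D) dA = u *m D *m contract (v *m D) dA.
Proof.
have K a b : b *m D *m contract (a *m D) dA =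
    \row_c \sum_l \sum_p (a *m D) 0 l * (b *m D) 0 p * hess c l p.
  apply/rowP => c; rewrite contractE mxE; apply/eqP.
  rewrite -subr_eq0 -sumrB; apply/eqP.
  transitivity (- \sum_p (b *m D) 0 p * \sum_e G p c e * (a *m D *m A) 0 e).
    have E p : \sum_e G p c e * (a *m D *m A) 0 e =
        \sum_l (a *m D) 0 l * \sum_e G p c e * A l e.
      under eq_bigr do rewrite mxE big_distrr.
      rewrite exchange_big; apply: eq_bigr => l _; rewrite big_distrr.
      by apply: eq_bigr => e _ /=; rewrite mulrCA.
    have -> : \sum_p (b *m D) 0 p * \sum_e G p c e * (a *m D *m A) 0 e =
        \sum_l \sum_p (a *m D) 0 l * (b *m D) 0 p * \sum_e G p c e * A l e.
      rewrite [RHS]exchange_big; apply: eq_bigr => p _; rewrite E big_distrr.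
      by apply: eq_bigr => l _ /=; rewrite mulrA [(b *m D) 0 p * _]mulrC.
    rewrite -sumrN; apply: eq_bigr => l _; rewrite -sumrB -sumrN.
    by apply: eq_bigr => p _; rewrite dAE mulrBr addrAC subrr add0r.
  rewrite big1 ?oppr0 // => p _.
  rewrite -mulmxA DA0 mulmx0 big1 ?mulr0 // => e _.
  by rewrite mxE mulr0.
rewrite !K; apply/rowP => c; rewrite !mxE exchange_big; apply: eq_bigr => l _.
apply: eq_bigr => p _.
have -> : hess c p l = hess c l p by rewrite -[in LHS](hess_sym c) mxE.
by rewrite [X in X * _]mulrC.
Qed.

Lemma contract_dW_cyclic (a b c : 'rV[R]_n) :
  (b *m contract a dW *m c^T) 0 0 + (c *m contract b dW *m a^T) 0 0 +
  (a *m contract c dW *m b^T) 0 0 = 0.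
Proof.
have E (x y z : 'rV[R]_n) : (y *m contract x dW *m z^T) 0 0 =
    \sum_i \sum_j \sum_k x 0 i * y 0 j * z 0 k * dW i j k.
  rewrite mxE (eq_bigr (fun k =>
    \sum_i \sum_j x 0 i * y 0 j * z 0 k * dW i j k)).
    rewrite exchange_big; apply: eq_bigr => i _; exact: exchange_big.
  move=> k _; rewrite contractE mxE big_distrl; apply: eq_bigr => i _ /=.
  by rewrite big_distrl; apply: eq_bigr => j _ /=; rewrite mulrAC.
rewrite !E.
have -> : \sum_i \sum_j \sum_k b 0 i * c 0 j * a 0 k * dW i j k =
    \sum_i \sum_j \sum_k a 0 i * b 0 j * c 0 k * dW j k i.
  rewrite [RHS]exchange_big; apply: eq_bigr => j _.
  rewrite [RHS]exchange_big; apply: eq_bigr => k _; apply: eq_bigr => i _ /=.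
  by ring.
have -> : \sum_i \sum_j \sum_k c 0 i * a 0 j * b 0 k * dW i j k =
    \sum_i \sum_j \sum_k a 0 i * b 0 j * c 0 k * dW k i j.
  rewrite exchange_big; apply: eq_bigr => i _.
  rewrite exchange_big; apply: eq_bigr => j _; apply: eq_bigr => k _ /=.
  by ring.
rewrite -!big_split big1 // => i _; rewrite -!big_split big1 // => j _.
rewrite -!big_split big1 // => k _ /=.
by rewrite -!mulrDr closedW mulr0.
Qed.

(** The value of [{f, {g, h}}] at a point, for functions with gradients [u, v, w]: the derivative
    along [u *m D] falls in turn on the gradient of [g] (Hessian [Hv]), on [D], and on the gradient
    of [h] (Hessian [Hw]). *)
Definition double_bracket (u v w : 'rV[R]_n) (Hv Hw : 'M[R]_n) : R :=
  (u *m D *m Hv *m D *m w^T) 0 0 + (v *m contract (u *m D) dD *m w^T) 0 0 +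
  (v *m D *m (u *m D *m Hw)^T) 0 0.

(** By [dbE] each double bracket consists of two Hessian terms [H], one term [W3] and two terms [K].
    In the cyclic sum each Hessian occurs twice with opposite signs, the [W3] terms add up to zero
    because the form is closed, and the six [K] terms cancel in pairs because [K] is symmetric in
    its first two arguments. *)
Lemma jacobi_algebra (u v w : 'rV[R]_n) (Hu Hv Hw : 'M[R]_n) :
  Hu^T = Hu -> Hv^T = Hv -> Hw^T = Hw ->
  double_bracket u v w Hv Hw + double_bracket v w u Hw Hu +
  double_bracket w u v Hu Hv = 0.
Proof.
move=> sHu sHv sHw.
have tr11 (X : 'M[R]_1) : X^T 0 0 = X 0 0 by rewrite mxE.
have D11 (X Y : 'M[R]_1) : (X + Y) 0 0 = X 0 0 + Y 0 0 by rewrite mxE.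
have N11 (X : 'M[R]_1) : (- X) 0 0 = - X 0 0 by rewrite mxE.
pose H (a b : 'rV[R]_n) (X : 'M[R]_n) : R := (a *m D *m X *m (b *m D)^T) 0 0.
pose K (a b c : 'rV[R]_n) : R :=
  (b *m D *m contract (a *m D) dA *m (c *m B)^T) 0 0.
pose W3 (a b c : 'rV[R]_n) : R :=
  (b *m D *m contract (a *m D) dW *m (c *m D)^T) 0 0.
have Ksym a b c : K a b c = K b a c by rewrite /K contract_dA_sym.
have W3cyc a b c : W3 a b c + W3 b c a + W3 c a b = 0.
  exact: contract_dW_cyclic.
have dDcontract a : contract (a *m D) dD =
    - (D *m contract (a *m D) dW *m D) - D *m contract (a *m D) dA *m B^T
    - B *m (contract (a *m D) dA)^T *m D.
  have mulS p q r (X : 'M[R]_(p, q)) (F : 'I_n -> 'M[R]_(q, r)) :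
      X *m (\sum_l (a *m D) 0 l *: F l) = \sum_l (a *m D) 0 l *: (X *m F l).
    by rewrite mulmx_sumr; apply: eq_bigr => l _; rewrite scalemxAr.
  have Smul p q r (X : 'M[R]_(q, r)) (F : 'I_n -> 'M[R]_(p, q)) :
      (\sum_l (a *m D) 0 l *: F l) *m X = \sum_l (a *m D) 0 l *: (F l *m X).
    by rewrite mulmx_suml; apply: eq_bigr => l _; rewrite scalemxAl.
  have -> : (contract (a *m D) dA)^T = \sum_l (a *m D) 0 l *: (dA l)^T.
    rewrite raddf_sum; apply: eq_bigr => l _.
    by apply/matrixP => i j; rewrite !mxE.
  rewrite /contract !(mulS, Smul) -!sumrN -!big_split /=.
  by apply: eq_bigr => l _; rewrite dDE !scalerDr !scalerN.
have DT (a : 'rV[R]_n) : D *m a^T = - (a *m D)^T.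
  by rewrite trmx_mul skewD mulNmx opprK.
have dbE a b c X Y : Y^T = Y -> double_bracket a b c X Y =
    - H a c X + H b a Y + W3 a b c - K a b c + K a c b.
  move=> sY; rewrite /double_bracket dDcontract.
  have -> : a *m D *m X *m D *m c^T = - (a *m D *m X *m (c *m D)^T).
    by rewrite -mulmxA DT mulmxN.
  have -> : b *m D *m (a *m D *m Y)^T = b *m D *m Y *m (a *m D)^T.
    by rewrite trmx_mul sY mulmxA.
  have -> : K a c b = (b *m B *m (contract (a *m D) dA)^T *m (c *m D)^T) 0 0.
    by rewrite /K -tr11 !trmx_mul !trmxK !mulmxA.
  set WW := contract _ dW; set AA := contract _ dA.
  have -> : b *m (- (D *m WW *m D) - D *m AA *m B^T - B *m AA^T *m D) *m c^T =
      b *m D *m WW *m (c *m D)^T - b *m D *m AA *m (c *m B)^T +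
      b *m B *m AA^T *m (c *m D)^T.
    rewrite !trmx_mul skewD !mulmxBr !mulmxBl.
    by rewrite !(mulmxN, mulNmx) !mulmxA.
  rewrite /H /K /W3 -/AA -/WW.
  by rewrite !(D11, N11); ring.
rewrite !dbE // (Ksym v u w) (Ksym w u v) (Ksym w v u) -(W3cyc u v w).
by ring.
Qed.
End JacobiAlgebra.

(** * The Dirac bivector field *)

(** Invertibility of [J] is read off from that of [X], so neither the Jacobian of a chart change nor
    the matrix of a frame change needs a separate argument. *)
Lemma invmx_congruence (R : comUnitRingType) (n : nat) (X Y J : 'M[R]_n) :
  X \in unitmx -> Y \in unitmx ->
  X = J *m Y *m J^T -> invmx Y = J^T *m invmx X *m J.
Proof.
move=> uX uY XE; have uJ : J \in unitmx.
  by move: uX; rewrite XE !unitmx_mul unitmx_tr => /andP[].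
apply: (can_inj (mulKmx uY)); rewrite mulmxV //; apply: (can_inj (mulKmx uJ)).
by rewrite mulmx1 !mulmxA -XE mulmxV // mul1mx.
Qed.

Lemma dirac_frame_change (R : comUnitRingType) (n m : nat)
    (P : 'M[R]_n) (A : 'M[R]_(n, m)) (L : 'M[R]_m) :
  A^T *m P *m A \in unitmx -> (A *m L)^T *m P *m (A *m L) \in unitmx ->
  P *m (A *m L) *m invmx ((A *m L)^T *m P *m (A *m L)) *m (A *m L)^T *m P =
  P *m A *m invmx (A^T *m P *m A) *m A^T *m P.
Proof.
set De := A^T *m P *m A => uDe.
have -> : (A *m L)^T *m P *m (A *m L) = L^T *m De *m L.
  by rewrite trmx_mul !mulmxA.
move=> uDL; rewrite (@invmx_congruence _ _ (L^T *m De *m L) De L^T) ?trmxK //.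
by rewrite trmx_mul !mulmxA.
Qed.

(** * Brackets of a bivector field in charts *)

Section Bracket.
Variables (R : realType) (n : nat) (M : manifold R n).
Implicit Types (c : chart R n M) (f g : M -> R) (x : M).

Lemma atlas_chart_at x : atlas (@chart_at R n M x).
Proof. by rewrite /chart_at; case: cid => c []. Qed.

Lemma chart_dom_chart_at x : chart_dom (@chart_at R n M x) x.
Proof. by rewrite /chart_at; case: cid => c []. Qed.

Definition grad c f x : 'rV[R]_n := \row_i partial c i f x.

Lemma bracket_in_grad c (B : chart R n M -> M -> 'M[R]_n) f g x :
  bracket_in c B f g x = (grad c f x *m B c x *m (grad c g x)^T) 0 0.
Proof.
rewrite mxE /bracket_in exchange_big; apply: eq_bigr => j _ /=.
by rewrite !mxE big_distrl; apply: eq_bigr => i _; rewrite mxE.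
Qed.

Lemma grad_change c c' f x : atlas c -> atlas c' ->
  chart_dom c x -> chart_dom c' x -> differentiable_in c' f x ->
  grad c f x = grad c' f x *m (transition_jacobian c c' x)^T.
Proof.
move=> ac ac' cx c'x df; apply/rowP => i.
rewrite !mxE (partial_change i ac ac') //.
by apply: eq_bigr => j _; rewrite !mxE mulrC.
Qed.

Lemma bracket_in_change c c' (B : bivector_field M) f g x :
  atlas c -> atlas c' ->
  chart_dom c x -> chart_dom c' x ->
  differentiable_in c' f x -> differentiable_in c' g x ->
  bracket_in c B f g x = bracket_in c' B f g x.
Proof.
move=> ac ac' cx c'x df dg.
rewrite !bracket_in_grad (bivector_tensor B ac ac' cx c'x).
rewrite (grad_change ac ac' cx c'x df) (grad_change ac ac' cx c'x dg).
by rewrite trmx_mul trmxK !mulmxA.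
Qed.

Lemma smooth_fun_differentiable c f x :
  atlas c -> chart_dom c x -> smooth_fun f ->
  differentiable_in c f x.
Proof.
by move=> ac cx sf; apply: smooth_fun_on_differentiable ac sf _ cx.
Qed.

Lemma bracketE c (B : bivector_field M) f g x : atlas c -> chart_dom c x ->
  smooth_fun f -> smooth_fun g -> bracket B f g x = bracket_in c B f g x.
Proof.
move=> ac cx sf sg; apply: bracket_in_change => //.
- exact: atlas_chart_at.
- exact: chart_dom_chart_at.
- exact: smooth_fun_differentiable.
- exact: smooth_fun_differentiable.
Qed.

(** The chart used by [bracket] varies with the point, so the bracket is first rewritten in the
    fixed chart [c], where it is a sum of products of smooth functions. *)
Lemma bracket_smooth (B : bivector_field M) f g :
  smooth_fun f -> smooth_fun g -> smooth_fun (bracket B f g).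
Proof.
move=> sf sg c ac; set O := (X in smooth_on X _).
have oO : open O by apply: open_chart_img; exact: openT.
apply: (@smooth_on_eq _ _ _ oO
  (fun p => \sum_i \sum_j partial c i f (chart_inv c p) *
     B c (chart_inv c p) i j * partial c j g (chart_inv c p))).
  by move=> p /chart_img_inv[_ cp _]; rewrite (bracketE B ac cp).
have sB i j : smooth_on O (fun p => B c (chart_inv c p) i j).
  apply: smooth_onS (bivector_smooth B i j ac ac).
  by move=> _ [x [_ cx] <-]; exists x.
apply: smooth_on_sum => // i _; apply: smooth_on_sum => // j _.
apply: smooth_on_mul => //; last exact: (smooth_on_partial_chart j ac openT sg).
by apply: smooth_on_mul => //; exact: (smooth_on_partial_chart i ac openT sf).
Qed.

End Bracket.

(** * Gluing the local components into one field *)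

Section DiracField.
Variables (R : realType) (n m : nat) (M : manifold R n).
Variables (omega : symplectic_form M) (V : vector_bundle M m).
Variables (Gamma : connection V) (theta : dual_section V).
Implicit Types (c : chart R n M) (e : local_frame m V) (U W : set M).

Lemma omega_inv_chart c c' x : atlas c -> atlas c' ->
  chart_dom c x -> chart_dom c' x ->
  omega_inv omega c' x = (transition_jacobian c c' x)^T *m
    omega_inv omega c x *m transition_jacobian c c' x.
Proof.
move=> ac ac' cx c'x; apply: invmx_congruence.
- exact: omega_nondegenerate.
- exact: omega_nondegenerate.
- exact: omega_tensor.
Qed.

Lemma dirac_comp_chart c c' e x : atlas c -> atlas c' -> frames e ->
  chart_dom c x -> chart_dom c' x -> frame_dom e x ->
  dirac_comp omega Gamma theta c' e x = (transition_jacobian c c' x)^T *m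
    dirac_comp omega Gamma theta c e x *m transition_jacobian c c' x.
Proof.
move=> ac ac' fe cx c'x ex.
have AE := nabla_theta_chart Gamma theta ac ac' fe cx c'x ex.
have PE := omega_inv_chart ac ac' cx c'x.
have DE : Delta omega Gamma theta c' e x = Delta omega Gamma theta c e x.
  by rewrite /Delta PE AE trmx_mul !mulmxA.
rewrite /dirac_comp DE AE PE trmx_mul mulmxBr mulmxBl !mulmxA.
by [].
Qed.

Lemma open_chart_frame c e : open (chart_dom c `&` frame_dom e).
Proof. by apply: openI; [exact: chart_dom_open|exact: frame_dom_open]. Qed.

Lemma connection_coef_smooth c e i a b : atlas c -> frames e ->
  smooth_fun_on (chart_dom c `&` frame_dom e) (connection_coef Gamma c e i a b).
Proof.
move=> ac fe; have := nabla_smooth Gamma i ac (frame_dom_open e)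
  (smooth_section_on_frame a fe).
by move=> /(_ e b fe); apply: smooth_fun_onS => x [].
Qed.

Lemma theta_comp_smooth c e a : atlas c -> frames e ->
  smooth_fun_on (chart_dom c `&` frame_dom e) (theta_comp theta e a).
Proof.
by move=> ac fe; apply: smooth_fun_onS (dual_section_smooth theta a fe) => x [].
Qed.

Lemma nabla_theta_smooth c e i a : atlas c -> frames e ->
  smooth_on (c @` ((chart_dom c `&` frame_dom e) `&` chart_dom c))
    (fun p => nabla_theta Gamma theta c e (chart_inv c p) i a).
Proof.
move=> ac fe; have oU := @open_chart_frame c e.
have oO := open_chart_img (c := c) oU.
under eq_fun do rewrite mxE.
apply: smooth_on_sub => //.
  exact: (smooth_on_partial_chart i ac oU (theta_comp_smooth a ac fe)).
apply: smooth_on_sum => // b _; apply: smooth_on_mul => //.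
  exact: (connection_coef_smooth i a b ac fe ac).
exact: (theta_comp_smooth b ac fe ac).
Qed.

Section Smooth.
Hypothesis hDelta : forall c e x,
  atlas c -> frames e -> chart_dom c x -> frame_dom e x ->
  Delta omega Gamma theta c e x \in unitmx.

Lemma dirac_comp_smooth c e i j : atlas c -> frames e ->
  smooth_fun_on (chart_dom c `&` frame_dom e)
    (fun x => dirac_comp omega Gamma theta c e x i j).
Proof.
move=> ac fe; have oU := @open_chart_frame c e.
apply: (smooth_fun_on_chart ac oU); first by move=> x [].
set O := (X in smooth_on X _); move: i j.
have oO : open O by exact: open_chart_img.
have sP : smooth_mx O (fun p => omega_inv omega c (chart_inv c p)).
  apply: smooth_mx_inv => //.
    by move=> p /chart_img_inv[_ cp _]; exact: omega_nondegenerate.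
  move=> i j; apply: smooth_onS (omega_smooth omega i j ac ac).
  by move=> _ [x [[cx _] _] <-]; exists x.
have sA : smooth_mx O (fun p => nabla_theta Gamma theta c e (chart_inv c p)).
  by move=> i a; exact: nabla_theta_smooth.
have sAt := smooth_mx_tr sA.
apply: smooth_mx_sub => //.
apply: smooth_mx_mul => //; apply: smooth_mx_mul => //.
apply: smooth_mx_mul => //; first exact: smooth_mx_mul.
apply: smooth_mx_inv => //.
  by move=> p /chart_img_inv[[_ ep] cp _]; exact: hDelta.
by apply: smooth_mx_mul => //; exact: smooth_mx_mul.
Qed.

Lemma dirac_comp_frame c e e' x : atlas c -> frames e -> frames e' ->
  chart_dom c x -> frame_dom e x -> frame_dom e' x ->
  dirac_comp omega Gamma theta c e' x = dirac_comp omega Gamma theta c e x.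
Proof.
move=> ac fe fe' cx ex e'x; congr (_ - _).
have AE := nabla_theta_frame Gamma theta ac fe fe' cx ex e'x.
have := hDelta ac fe' cx e'x; rewrite /Delta AE => uD'.
by apply: dirac_frame_change uD'; exact: hDelta.
Qed.

Definition frame_at (x : M) : local_frame m V := sval (cid (frames_cover V x)).

Lemma frames_frame_at x : frames (frame_at x).
Proof. by rewrite /frame_at; case: cid => e []. Qed.

Lemma frame_dom_frame_at x : frame_dom (frame_at x) x.
Proof. by rewrite /frame_at; case: cid => e []. Qed.

(** The chosen frame may jump from point to point. By [dirac_comp_frame] the value does not depend
    on it, so smoothness near [x] can be checked with the frame chosen at [x] held fixed. *)
Definition dirac_field_comp c x :=
  dirac_comp omega Gamma theta c (frame_at x) x.

Lemma dirac_field_compE c e x : atlas c -> frames e ->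
  chart_dom c x -> frame_dom e x ->
  dirac_field_comp c x = dirac_comp omega Gamma theta c e x.
Proof.
move=> ac fe cx ex; apply: dirac_comp_frame => //.
- exact: frames_frame_at.
- exact: frame_dom_frame_at.
Qed.

Lemma dirac_field_smooth c i j : atlas c ->
  smooth_fun_on (chart_dom c) (fun x => dirac_field_comp c x i j).
Proof.
move=> ac; apply: smooth_fun_on_local => x cx.
exists (fun y => dirac_comp omega Gamma theta c (frame_at x) y i j).
exists (chart_dom c `&` frame_dom (frame_at x)).
have fx := frames_frame_at x; split.
- exact: open_chart_frame.
- by split=> //; exact: frame_dom_frame_at.
- exact: dirac_comp_smooth.
- by move=> y [cy ey]; rewrite (dirac_field_compE ac fx cy ey).
Qed.

Lemma dirac_field_tensor c c' x : atlas c -> atlas c' ->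
  chart_dom c x -> chart_dom c' x ->
  dirac_field_comp c' x = (transition_jacobian c c' x)^T *m
    dirac_field_comp c x *m transition_jacobian c c' x.
Proof.
move=> ac ac' cx c'x; apply: dirac_comp_chart => //.
- exact: frames_frame_at.
- exact: frame_dom_frame_at.
Qed.

Lemma dirac_field_skew c x : atlas c -> chart_dom c x ->
  (dirac_field_comp c x)^T = - dirac_field_comp c x.
Proof.
move=> ac cx; apply: dirac_skew.
- exact: omega_nondegenerate.
- exact: omega_skew.
- exact: hDelta ac (frames_frame_at x) cx (frame_dom_frame_at x).
Qed.

Definition dirac_field : bivector_field M :=
  BivectorField dirac_field_smooth dirac_field_tensor dirac_field_skew.

End Smooth.
End DiracField.

(** * The Jacobi identity on the constraint surface *)

Section MatrixDerivative.
Variables (R : realType) (n : nat).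
Implicit Types (p : 'rV[R]_n).

Definition mx_differentiable a b (X : 'rV[R]_n -> 'M[R]_(a, b)) p :=
  forall i j, differentiable (fun q => X q i j) p.

Definition mx_deriv a b (l : 'I_n) (X : 'rV[R]_n -> 'M[R]_(a, b)) p :=
  \matrix_(i, j) 'd_l (fun q => X q i j) p.

Lemma mx_deriv_near_eq a b l (X Y : 'rV[R]_n -> 'M[R]_(a, b)) p :
  (\forall q \near p, X q = Y q) -> mx_deriv l X p = mx_deriv l Y p.
Proof.
move=> XY; apply/matrixP => i j; rewrite !mxE; apply: near_eq_derive.
by apply: filterS XY => q ->.
Qed.

Lemma mx_deriv_cst a b l (X : 'M[R]_(a, b)) p : mx_deriv l (fun=> X) p = 0.
Proof. by apply/matrixP => i j; rewrite !mxE derive_cst. Qed.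

Lemma mx_differentiable_tr a b (X : 'rV[R]_n -> 'M[R]_(a, b)) p :
  mx_differentiable X p -> mx_differentiable (fun q => (X q)^T) p.
Proof. by move=> dX i j; under eq_fun do rewrite mxE; exact: dX. Qed.

Lemma mx_deriv_tr a b l (X : 'rV[R]_n -> 'M[R]_(a, b)) p :
  mx_deriv l (fun q => (X q)^T) p = (mx_deriv l X p)^T.
Proof.
apply/matrixP => i j; rewrite !mxE.
by congr derive; apply/funext => q; rewrite mxE.
Qed.

Lemma mulmx_entryE a b c (X : 'rV[R]_n -> 'M[R]_(a, b))
    (Y : 'rV[R]_n -> 'M[R]_(b, c)) i j :
  (fun q => (X q *m Y q) i j) =
  \sum_k ((fun q => X q i k) * (fun q => Y q k j)).
Proof. by apply/funext => q; rewrite mxE fct_sumE. Qed.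

Lemma mx_differentiable_mul a b c (X : 'rV[R]_n -> 'M[R]_(a, b))
    (Y : 'rV[R]_n -> 'M[R]_(b, c)) p :
  mx_differentiable X p -> mx_differentiable Y p ->
  mx_differentiable (fun q => X q *m Y q) p.
Proof.
move=> dX dY i j; rewrite mulmx_entryE.
by apply: differentiable_sum => k; exact: differentiableM.
Qed.

Lemma mx_deriv_mul a b c l (X : 'rV[R]_n -> 'M[R]_(a, b))
    (Y : 'rV[R]_n -> 'M[R]_(b, c)) p :
  mx_differentiable X p -> mx_differentiable Y p ->
  mx_deriv l (fun q => X q *m Y q) p =
    mx_deriv l X p *m Y p + X p *m mx_deriv l Y p.
Proof.
move=> dX dY; apply/matrixP => i j; rewrite [LHS]mxE mulmx_entryE derive_sum.
  rewrite !mxE -big_split /=; apply: eq_bigr => k _.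
  rewrite deriveM; [|exact: diff_derivable|exact: diff_derivable].
  by rewrite !mxE addrC; congr (_ + _); exact: mulrC.
by move=> k; apply: diff_derivable; exact: differentiableM.
Qed.

End MatrixDerivative.

(** Links the expression treated by [jacobi_algebra] to the one that the product rule yields in
    [partial_dirac_bracket], summed over the direction [l]. *)
Lemma double_bracketE (R : comNzRingType) (n : nat) (D : 'M[R]_n)
    (dD : 'I_n -> 'M[R]_n) (u v w : 'rV[R]_n) (Hv Hw : 'M[R]_n) :
  double_bracket D dD u v w Hv Hw = \sum_l (u *m D) 0 l *
    ((row l Hv *m D + v *m dD l) *m w^T + v *m D *m (row l Hw)^T) 0 0.
Proof.
rewrite /double_bracket; move: (u *m D) => a.
have E (F : 'I_n -> 'M[R]_1) :
    \sum_l a 0 l * F l 0 0 = (\sum_l a 0 l *: F l) 0 0.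
  by rewrite summxE; apply: eq_bigr => l _; rewrite mxE.
rewrite E.
have -> : v *m D *m (a *m Hw)^T = \sum_l a 0 l *: (v *m D *m (row l Hw)^T).
  rewrite [a *m Hw]mulmx_sum_row raddf_sum mulmx_sumr; apply: eq_bigr => l _.
  rewrite scalemxAr; congr (_ *m _); apply/matrixP => i j. by rewrite !mxE.
have -> : v *m contract a dD *m w^T = \sum_l a 0 l *: (v *m dD l *m w^T).
  rewrite mulmx_sumr mulmx_suml; apply: eq_bigr => l _.
  by rewrite -scalemxAr -scalemxAl.
have -> : a *m Hv *m D *m w^T = \sum_l a 0 l *: (row l Hv *m D *m w^T).
  rewrite [a *m Hv]mulmx_sum_row !mulmx_suml; apply: eq_bigr => l _.
  by rewrite -!scalemxAl.
have add00 (X Y : 'M[R]_1) : X 0 0 + Y 0 0 = (X + Y) 0 0 by rewrite mxE.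
rewrite !add00 -!big_split /=; congr (fun_of_matrix _ 0 0).
by apply: eq_bigr => l _; rewrite mulmxDl -!scalerDr.
Qed.

(** * The Dirac bracket at points of the constraint surface *)

Section OnConstraintSurface.
Variables (R : realType) (n m : nat) (M : manifold R n).
Variables (omega : symplectic_form M) (V : vector_bundle M m).
Variables (Gamma : connection V) (theta : dual_section V).
Implicit Types (c : chart R n M) (e : local_frame m V) (f g h : M -> R).
Hypothesis hDelta : forall c e x,
  atlas c -> frames e -> chart_dom c x -> frame_dom e x ->
  Delta omega Gamma theta c e x \in unitmx.

Lemma theta_comp_surface e a x : constraint_surface theta x ->
  theta_comp theta e a x = 0.
Proof. by rewrite /theta_comp => ->; rewrite lfunE. Qed.

Lemma nabla_theta_surface c e x i a : constraint_surface theta x ->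
  nabla_theta Gamma theta c e x i a = partial c i (theta_comp theta e a) x.
Proof.
move=> x0; rewrite mxE big1 ?subr0 // => b _.
by rewrite theta_comp_surface // mulr0.
Qed.

Lemma tr_nabla_theta_surface c e x a : constraint_surface theta x ->
  row a (nabla_theta Gamma theta c e x)^T = grad c (theta_comp theta e a) x.
Proof.
by move=> x0; apply/rowP => i; rewrite 2!mxE nabla_theta_surface // mxE.
Qed.

Lemma poisson_grad f g x :
  poisson omega f g x =
    (grad (chart_at x) f x *m omega_inv omega (chart_at x) x *m
     (grad (chart_at x) g x)^T) 0 0.
Proof. exact: bracket_in_grad. Qed.

Lemma Delta0E e x : constraint_surface theta x ->
  Delta0 omega theta e x = Delta omega Gamma theta (chart_at x) e x.
Proof.
move=> x0; apply/matrixP => a b; rewrite mxE poisson_grad.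
rewrite -!(tr_nabla_theta_surface _ _ _ x0) /Delta.
set A := nabla_theta _ _ _ _ _; set P := omega_inv _ _ _.
rewrite [LHS]mxE [RHS]mxE; apply: eq_bigr => k _; rewrite !mxE; congr (_ * _).
by apply: eq_bigr => i _; rewrite !mxE.
Qed.

Lemma bracket_conventional e f g x : frames e -> frame_dom e x ->
  constraint_surface theta x ->
  bracket (dirac_field hDelta) f g x = conventional_dirac omega theta e f g x.
Proof.
move=> fe ex x0; set c := chart_at x.
have ac : atlas c by exact: atlas_chart_at.
have cx : chart_dom c x by exact: chart_dom_chart_at.
rewrite /bracket -/c bracket_in_grad /conventional_dirac !poisson_grad -/c.
rewrite Delta0E //.
rewrite -/c /= (dirac_field_compE hDelta ac fe cx ex) /dirac_comp.
set A := nabla_theta _ _ _ _ _; set P := omega_inv _ _ _.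
set De := Delta _ _ _ _ _ _.
rewrite mulmxBr mulmxBl [LHS]mxE; congr (_ + _).
rewrite [LHS]mxE; congr (- _); rewrite !mulmxA -[_ *m P *m _ ^T]mulmxA.
have fA a : poisson omega f (theta_comp theta e a) x =
    (grad c f x *m P *m A) 0 a.
  rewrite poisson_grad -(tr_nabla_theta_surface _ _ _ x0) [LHS]mxE [RHS]mxE.
  by apply: eq_bigr => k _; rewrite !mxE.
have Ag b : poisson omega (theta_comp theta e b) g x =
    (A^T *m (P *m (grad c g x)^T)) b 0.
  rewrite poisson_grad -(tr_nabla_theta_surface _ _ _ x0) -mulmxA.
  rewrite [LHS]mxE [RHS]mxE.
  by apply: eq_bigr => k _; rewrite [X in X * _ = _]mxE.
rewrite -[_ *m A^T *m _]mulmxA [LHS]mxE [RHS]exchange_big /=.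
apply: eq_bigr => b _.
rewrite -Ag [X in X * _]mxE big_distrl; apply: eq_bigr => a _ /=.
by rewrite -fA.
Qed.

Definition hessian c f x : 'M[R]_n :=
  \matrix_(l, i) 'd_l ('d_i (fun p => f (chart_inv c p))) (c x).

(** Stated relative to an open [U] because it is applied to the components of theta, smooth on a
    frame domain, as well as to functions smooth on [M]. *)
Lemma hessian_sym c f U x : atlas c -> open U -> smooth_fun_on U f ->
  U x -> chart_dom c x -> (hessian c f x)^T = hessian c f x.
Proof.
move=> ac oU sf Ux cx; apply/matrixP => l i; rewrite !mxE.
have sf' := sf c ac.
have Ox : (c @` (U `&` chart_dom c)) (c x) by exists x.
have d1 k := smooth_on_differentiable (smooth_on_partial k sf') Ox.
apply: (derive_comm _ (d1 l) (d1 i)).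
have : \forall q \near c x, (c @` (U `&` chart_dom c)) q.
  by apply: open_nbhs_nbhs; split=> //; exact: open_chart_img.
by apply: filterS => q; exact: smooth_on_differentiable sf'.
Qed.

(** * Derivatives at a point, in a fixed chart and frame *)

Section AtPoint.
Variables (c : chart R n M) (e : local_frame m V) (x : M).
Hypotheses (ac : atlas c) (fe : frames e) (cx : chart_dom c x).
Hypothesis ex : frame_dom e x.

Let Wm p := omega c (chart_inv c p).
Let Am p := nabla_theta Gamma theta c e (chart_inv c p).
Let Dm p := dirac_comp omega Gamma theta c e (chart_inv c p).
Let O := c @` ((chart_dom c `&` frame_dom e) `&` chart_dom c).

Let oO : open O.
Proof. by apply: open_chart_img; exact: open_chart_frame. Qed.

Let Ox : O (c x).
Proof. by exists x. Qed.

Let nearO : \forall q \near c x, O q.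
Proof. exact: open_nbhs_nbhs. Qed.

Let dWm : mx_differentiable Wm (c x).
Proof.
move=> i j.
exact: smooth_fun_on_differentiable ac (omega_smooth omega i j ac) cx cx.
Qed.

Let dAm : mx_differentiable Am (c x).
Proof.
by move=> i a; apply: smooth_on_differentiable Ox; exact: nabla_theta_smooth.
Qed.

Let dDm : mx_differentiable Dm (c x).
Proof.
move=> i j; apply: smooth_on_differentiable Ox.
exact: (dirac_comp_smooth hDelta i j ac fe ac).
Qed.

Lemma dirac_comp_derivation l (B := omega_inv omega c x *m
    nabla_theta Gamma theta c e x *m invmx (Delta omega Gamma theta c e x)) :
  let D := dirac_comp omega Gamma theta c e x in
  mx_deriv l Dm (c x) = - (D *m mx_deriv l Wm (c x) *m D) -
    D *m mx_deriv l Am (c x) *m B^T - B *m (mx_deriv l Am (c x))^T *m D.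
Proof.
(* The identities of the matrix algebra can be differentiated only if they hold near [c x], so their
   hypotheses are checked at every point of [O]. *)
have hO q : O q -> [/\ Wm q \in unitmx, (Wm q)^T = - Wm q &
    (Am q)^T *m invmx (Wm q) *m Am q \in unitmx].
  move=> /chart_img_inv[[_ eq] cq _]; split.
  - exact: omega_nondegenerate.
  - exact: omega_skew.
  - exact: hDelta.
have [uW sW uD] := hO _ Ox.
have [Dx Wx Ax] : [/\ Dm (c x) = dirac_comp omega Gamma theta c e x,
    Wm (c x) = omega c x & Am (c x) = nabla_theta Gamma theta c e x].
  by rewrite /Dm /Wm /Am chart_mapK.
rewrite /= /B -Dx -Ax /Delta /omega_inv -Ax -Wx.
apply: dirac_derivation.
- exact: dirac_W_mul.
- exact: dirac_mul_W.
- rewrite -mx_deriv_mul // -mx_deriv_mul //; last exact: mx_differentiable_mul.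
  apply: mx_deriv_near_eq; apply: filterS nearO => q /hO[uWq sWq uDq].
  by apply/esym; exact: dirac_mul_W_mul.
- rewrite -mx_deriv_mul // -[RHS](mx_deriv_cst l 0 (c x)).
  apply: mx_deriv_near_eq; apply: filterS nearO => q /hO[uWq sWq uDq].
  exact: dirac_mulA.
- rewrite -mx_deriv_tr -mx_deriv_mul //; last exact: mx_differentiable_tr.
  rewrite -[RHS](mx_deriv_cst l 0 (c x)).
  apply: mx_deriv_near_eq; apply: filterS nearO => q /hO[uWq sWq uDq].
  exact: dirac_trA_mul.
Qed.

Lemma partial_dirac_bracket l f g : smooth_fun f -> smooth_fun g ->
  let D := dirac_comp omega Gamma theta c e x in
  partial c l (bracket (dirac_field hDelta) f g) x =
    ((row l (hessian c f x) *m D + grad c f x *m mx_deriv l Dm (c x)) *m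
       (grad c g x)^T +
     grad c f x *m D *m (row l (hessian c g x))^T) 0 0.
Proof.
move=> sf sg D.
pose G h q : 'rV[R]_n := \row_i 'd_i (fun p => h (chart_inv c p)) q.
have Gx h : G h (c x) = grad c h x by apply/rowP => i; rewrite !mxE.
have dG h : smooth_fun h -> mx_differentiable (G h) (c x).
  move=> sh i j; under eq_fun do rewrite mxE.
  apply: smooth_on_differentiable; first exact/smooth_on_partial/(sh c ac).
  by exists x.
have G' h : mx_deriv l (G h) (c x) = row l (hessian c h x).
  apply/matrixP => i j; rewrite !mxE.
  by congr derive; apply/funext => q; rewrite mxE.
have Dx : Dm (c x) = D by rewrite /Dm chart_mapK.
(* Near [c x] the bracket is a product of three matrices in the fixed chart and frame, and the
   product rule applies. *)
transitivity (mx_deriv l (fun q => G f q *m Dm q *m (G g q)^T) (c x) 0 0).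
  rewrite mxE; apply: near_eq_derive; apply: filterS nearO => q.
  move=> /chart_img_inv[[_ eq] cq qE].
  rewrite (bracketE _ ac cq sf sg) bracket_in_grad /=.
  rewrite (dirac_field_compE hDelta ac fe cq eq).
  have gradE h : grad c h (chart_inv c q) = G h q.
    by apply/rowP => i; rewrite !mxE /partial qE.
  by rewrite !gradE.
have dGf := dG f sf; have dGg := mx_differentiable_tr (dG g sg).
rewrite mx_deriv_mul //; last exact: mx_differentiable_mul.
by rewrite mx_deriv_mul // mx_deriv_tr !G' !Gx Dx.
Qed.

Lemma mx_deriv_nabla_theta l p a : constraint_surface theta x ->
  mx_deriv l Am (c x) p a = hessian c (theta_comp theta e a) x l p -
    \sum_b connection_coef Gamma c e p a b x *
      nabla_theta Gamma theta c e x l b.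
Proof.
move=> x0; rewrite !mxE.
pose th b q := theta_comp theta e b (chart_inv c q).
pose ga b q := connection_coef Gamma c e p a b (chart_inv c q).
have dth b : differentiable (th b) (c x).
  exact: smooth_fun_on_differentiable ac (theta_comp_smooth theta b ac fe) _ cx.
have dga b : differentiable (ga b) (c x).
  have sga := connection_coef_smooth Gamma p a b ac fe.
  exact: smooth_fun_on_differentiable ac sga _ cx.
have dpth : differentiable ('d_p (th a)) (c x).
  apply: smooth_on_differentiable Ox; apply: smooth_on_partial.
  exact: (theta_comp_smooth theta a ac fe ac).
transitivity ('d_l ('d_p (th a) - \sum_b (ga b * th b)) (c x)).
  apply: near_eq_derive; apply: filterS nearO => q /chart_img_inv[_ _ qE].
  by rewrite mxE /partial qE [RHS]/(_ - _) fct_sumE.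
have dgath b : derivable (ga b * th b) (c x) (delta_mx 0 l).
  by apply: diff_derivable; exact: differentiableM.
rewrite deriveB; [|exact: diff_derivable|exact: derivable_sum].
rewrite derive_sum //; congr (_ - _); apply: eq_bigr => b _.
rewrite deriveM; [|exact: diff_derivable|exact: diff_derivable].
(* At [x] the derivative of the connection coefficient is multiplied by [theta_b = 0], and in the
   other term [d_l theta_b] equals [A_lb]. *)
rewrite nabla_theta_surface // /th /ga chart_mapK // theta_comp_surface //.
by rewrite scale0r addr0.
Qed.

End AtPoint.

Lemma dirac_jacobi f g h x : smooth_fun f -> smooth_fun g -> smooth_fun h ->
  constraint_surface theta x ->
  bracket (dirac_field hDelta) f (bracket (dirac_field hDelta) g h) x +
  bracket (dirac_field hDelta) g (bracket (dirac_field hDelta) h f) x +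
  bracket (dirac_field hDelta) h (bracket (dirac_field hDelta) f g) x = 0.
Proof.
move=> sf sg sh x0.
set c := @chart_at R n M x; set e := @frame_at R n m M V x.
have ac : atlas c by exact: atlas_chart_at.
have cx : chart_dom c x by exact: chart_dom_chart_at.
have fe : frames e by exact: frames_frame_at.
have ex : frame_dom e x by exact: frame_dom_frame_at.
set D := dirac_comp omega Gamma theta c e x.
pose dD l := mx_deriv l
  (fun p => dirac_comp omega Gamma theta c e (chart_inv c p)) (c x).
have E u v w : smooth_fun u -> smooth_fun v -> smooth_fun w ->
    bracket (dirac_field hDelta) u (bracket (dirac_field hDelta) v w) x =
    double_bracket D dD (grad c u x) (grad c v x) (grad c w x)
      (hessian c v x) (hessian c w x).
  move=> su sv sw; rewrite double_bracketE /bracket -/c bracket_in_grad mxE.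
  apply: eq_bigr => l _; rewrite /= (dirac_field_compE hDelta ac fe cx ex).
  by congr (_ * _); rewrite 2!mxE (partial_dirac_bracket ac fe cx ex).
rewrite !E //; have Hsym u : smooth_fun u -> (hessian c u x)^T = hessian c u x.
  by move=> su; apply: hessian_sym su _ cx => //; exact: openT.
have [uW sW uD] : [/\ omega c x \in unitmx, (omega c x)^T = - omega c x &
    Delta omega Gamma theta c e x \in unitmx].
  by split; [exact: omega_nondegenerate|exact: omega_skew|exact: hDelta].
apply: (@jacobi_algebra _ _ _ D (nabla_theta Gamma theta c e x)
  (omega_inv omega c x *m nabla_theta Gamma theta c e x *m
     invmx (Delta omega Gamma theta c e x)) dD
  (fun l => mx_deriv l (fun p => omega c (chart_inv c p)) (c x))
  (fun l => mx_deriv l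
     (fun p => nabla_theta Gamma theta c e (chart_inv c p)) (c x))
  (fun a => hessian c (theta_comp theta e a) x)
  (fun p => \matrix_(a, b) connection_coef Gamma c e p a b x)).
- exact: dirac_skew.
- exact: dirac_mulA.
- by move=> l; exact: dirac_comp_derivation.
- move=> l p a; rewrite mx_deriv_nabla_theta //; congr (_ - _).
  by apply: eq_bigr => b _; rewrite [X in _ = X * _]mxE.
- move=> a; apply: hessian_sym (theta_comp_smooth theta a ac fe) (conj cx ex) cx.
    exact: ac.
  exact: open_chart_frame.
- by move=> i j k; rewrite !mxE; exact: omega_closed.
- exact: Hsym.
- exact: Hsym.
- exact: Hsym.
Qed.

End OnConstraintSurface.

Unset Implicit Arguments.
Set Strict Implicit.

Theorem mainTheorem5 (R : realType) (n m : nat) (M : manifold R n)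
    (omega : symplectic_form M) (V : vector_bundle M m) (Gamma : connection V)
    (theta : dual_section V) (hsc : second_class omega theta)
    (hDelta : forall (c : chart R n M) (e : local_frame m V) (x : M),
       atlas c -> frames e -> chart_dom c x -> frame_dom e x ->
       Delta omega Gamma theta c e x \in unitmx) :
  exists D : bivector_field M,
    (* D has the components D^{ij} in every chart and every local frame *)
    (forall (c : chart R n M) (e : local_frame m V) (x : M),
       atlas c -> frames e -> chart_dom c x -> frame_dom e x ->
       D c x = dirac_comp omega Gamma theta c e x) /\
    (* {f, g}_D is a smooth function, given by d_i f D^{ij} d_j g in every chart *)
    (forall f g : M -> R, smooth_fun f -> smooth_fun g ->
       smooth_fun (bracket D f g) /\
       forall (c : chart R n M) (x : M), atlas c -> chart_dom c x ->
         bracket D f g x = bracket_in c D f g x) /\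
    (* on Sigma it is the conventional Dirac bracket *)
    (forall (e : local_frame m V) (x : M),
       frames e -> frame_dom e x -> constraint_surface theta x ->
       Delta0 omega theta e x \in unitmx /\
       forall f g : M -> R, smooth_fun f -> smooth_fun g ->
         bracket D f g x = conventional_dirac omega theta e f g x) /\
    (* Jacobi identity on Sigma *)
    (forall f g h : M -> R, smooth_fun f -> smooth_fun g -> smooth_fun h ->
       forall x : M, constraint_surface theta x ->
         bracket D f (bracket D g h) x + bracket D g (bracket D h f) x +
         bracket D h (bracket D f g) x = 0).
Proof.
exists (dirac_field hDelta); split; [|split; [|split]].
- by move=> c e x ac fe cx ex; exact: (dirac_field_compE hDelta ac fe cx ex).
- move=> f g sf sg; split; first exact: bracket_smooth.
  by move=> c x ac cx; exact: bracketE.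
- move=> e x fe ex x0; split; last first.
    by move=> f g _ _; exact: bracket_conventional.
  rewrite (Delta0E omega Gamma e x0); apply: hDelta => //.
  + exact: atlas_chart_at.
  + exact: chart_dom_chart_at.
- by move=> f g h sf sg sh x x0; exact: dirac_jacobi.
Qed.
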